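(* Let $k\ge 2$ be a fixed integer and let $f\in\mathcal{A}_1$. Then for every $\varepsilon>0$, $$\sum_{\substack{n_1,\ldots,n_k\in\mathbb{N}\\ n_1^2+\cdots+n_k^2\le x}}f([n_1,\ldots,n_k])=\frac{C_{f,k}}{2^k\,k!}\,x^k+O\left(x^{k-1/4+\varepsilon}\right),$$ where $$C_{f,k}=\prod_p\left(1-\frac1p\right)^k\sum_{\nu_1,\ldots,\nu_k=0}^{\infty}\frac{f(p^{\max(\nu_1,\ldots,\nu_k)})}{p^{2(\nu_1+\cdots+\nu_k)}}.$$
   Context: $\mathbb{N}=\{1,2,\ldots\}$, $[n_1,\ldots,n_k]$ is the least common multiple, and $\prod_p$ runs over all primes. $\mathcal{A}_1$ is the class of multiplicative functions $f:\mathbb{N}\to\mathbb{C}$ for which there exist real constants $C_1,C_2$ such that $|f(p)-p|\le C_1\,p^{1/2}$ for every prime $p$ and $|f(p^{\nu})|\le C_2\,p^{\nu}$ for every prime power $p^{\nu}$ with $\nu\ge 2$. The $O$-estimate is as $x\to\infty$, with implied constant depending only on $f$, $k$ and $\varepsilon$. *)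

(* Defs.v *)
From mathcomp Require Export all_boot all_order all_algebra.
From mathcomp Require Export complex.
From mathcomp Require Export all_classical all_reals all_analysis.
From mathcomp Require Import showcase.summability.

Set Implicit Arguments.
Unset Strict Implicit.
Unset Printing Implicit Defensive.

Import Order.TTheory GRing.Theory Num.Theory.
Export numFieldNormedType.Exports.

Local Open Scope classical_set_scope.
Local Open Scope complex_scope.
Local Open Scope ring_scope.

(* An arithmetic function on {1, 2, ...} is a total function on nat whose
   value at 0 is never constrained nor used. *)
Definition multiplicative_fun (R : realType) (f : nat -> R[i]) : Prop :=
  f 1%N = 1 /\
  forall m n : nat,
    (0 < m)%N -> (0 < n)%N -> coprime m n -> f (m * n)%N = f m * f n.

(* The norm of R[i] takes its values in R[i], hence the injections %:C. *)
Definition class_A1 (R : realType) (f : nat -> R[i]) : Prop :=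
  multiplicative_fun f /\
  exists C1 C2 : R,
    (forall p : nat, prime p ->
       `|f p - p%:R| <= (C1 * Num.sqrt p%:R)%:C) /\
    (forall p nu : nat, prime p -> (2 <= nu)%N ->
       `|f (p ^ nu)%N| <= (C2 * (p ^ nu)%:R)%:C).

Definition lcm_tuple (k : nat) (n : {ffun 'I_k -> nat}) : nat :=
  \big[lcmn/1%N]_(i < k) n i.

(* The index set is finite, so this \sum over a classical set is the ordinary
   finite sum (and not the default value 0 of infinitely supported sums). *)
Definition lcm_sum (R : realType) (f : nat -> R[i]) (k : nat) (x : R) : R[i] :=
  \sum_(n \in [set n : {ffun 'I_k -> nat} |
          (forall i, (0 < n i)%N) /\ (\sum_(i < k) n i ^ 2)%N%:R <= x])
    f (lcm_tuple n).

Definition local_term (R : realType) (f : nat -> R[i]) (k p : nat)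
    (nu : {ffun 'I_k -> nat}) : R[i]^o :=
  f (p ^ (\max_(i < k) nu i))%N / p%:R ^+ (2 * \sum_(i < k) nu i)%N.

(* Convergence and value of the k-fold series are unconditional: limits of the
   finite partial sums along the directed set of finite subsets of nat^k; in
   R[i] this convergence is absolute convergence. *)
Definition local_series_cvg (R : realType) (f : nat -> R[i]) (k p : nat) :
    Prop :=
  cvg (partial_sum (local_term f p (k := k)) @ totally).

Definition local_factor (R : realType) (f : nat -> R[i]) (k p : nat) : R[i] :=
  (1 - p%:R^-1) ^+ k * summability.sum (local_term f p (k := k)).

Definition euler_partial (R : realType) (f : nat -> R[i]) (k N : nat) :
    R[i]^o :=
  \prod_(0 <= p < N | prime p) local_factor f k p.

Definition euler_constant (R : realType) (f : nat -> R[i]) (k : nat) : R[i] :=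
  limn (euler_partial f k).

(* Main.v *)
Require Import Defs.
From mathcomp Require Import finmap ring lra.
From mathcomp Require Import showcase.summability.

(** Write [F n = f (lcm n)] on [k]-tuples and [h_p l = f (p^(max l))] on tuples of
exponents.  Since [f p] is close to [p], the function [F] behaves like
[n_1 ... n_k]: one divides it, in the sense of Dirichlet convolution in [k]
variables, by that product.  This gives a multiplicative coefficient [G] with
[F n = \sum_(d_i | n_i) G d * \prod_i (n_i / d_i)], whose local part at [p],
[conv_inv], has the generating series
[\prod_i (1 - p X_i) * \sum_l h_p l X^l].  It is [1] in degree [0], is
[f p - p = O(p^(1/2))] in degree [1], and is [O(p^n)] in degree [n]; hence
[\sum_d |G d| / \prod_i d_i^s] converges for every [s > 3/2].  Exchanging the
sums,
[\sum_n F n = \sum_d G d * \sum_(\sum (d_i m_i)^2 <= x) \prod_i m_i].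

The inner sum is [x^k / (2^k k! \prod d_i^2)] with a relative error
[O(\sum d_i / sqrt x)] ([lattice_sum_asymp], by induction on [k], each coordinate
being summed by telescoping a primitive).  Together with the trivial bound this
yields the relative error [O((\prod d_i / sqrt x)^theta)] for each [theta] in
[[0, 1]] ([lattice_sum_interp]).  Taking [theta] just below [1/2] keeps the series
over [d] convergent and saves [x^(theta / 2)], close to [x^(1/4)].  The main terms
add up to [x^k / (2^k k!)] times [\sum_d G d / \prod d_i^2], which is the Euler
product: at [p], the series of [conv_inv] at [X_i = p^-2] is
[(1 - p^-1)^k] times that of [h_p].

No infinite sum over tuples of integers is formed.  For a given [x] only primes
below some [N] and exponents up to some [E] occur, so [d] is encoded by a finite
matrix of exponents; sums over [d] of multiplicative terms are then finite
products over primes of finite sums ([lcm_tuple_expansion],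
[lcm_sum_truncated]).  The resulting error is bounded uniformly in [N] and [E]
([local_bounds], [bounded_sum_powRN]), so [E] and then [N] can tend to infinity in
the main term. *)

Set Implicit Arguments.
Unset Strict Implicit.
Unset Printing Implicit Defensive.

Import Order.TTheory GRing.Theory Num.Theory.
Import ComplexField.Normc.

Local Open Scope classical_set_scope.
Local Open Scope complex_scope.
Local Open Scope ring_scope.

(** * Modulus and convergence in the complex numbers *)

Lemma normC_normc (R : realType) (z : R[i]) : `|z| = (normc z)%:C.
Proof. by case: z. Qed.

Lemma normc_ge0 (R : realType) (z : R[i]) : 0 <= normc z.
Proof. by case: z => a b; exact: sqrtr_ge0. Qed.

Lemma normc_real (R : realType) (x : R) : normc x%:C = `|x|.
Proof. by rewrite /normc /= expr0n /= addr0 sqrtr_sqr. Qed.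

Lemma real_complex_nat (R : realType) (n : nat) : (n%:R : R)%:C = n%:R :> R[i].
Proof. exact: rmorph_nat. Qed.

Lemma normc_nat (R : realType) (n : nat) : normc (n%:R : R[i]) = n%:R.
Proof. by rewrite -real_complex_nat normc_real normr_nat. Qed.

Lemma normcX (R : realType) (z : R[i]) n : normc (z ^+ n) = normc z ^+ n.
Proof. by elim: n => [|n IH]; rewrite ?expr0 ?normc1 // !exprS normcM IH. Qed.

Lemma normc_prod (R : realType) (I : Type) (r : seq I) (P : pred I)
    (F : I -> R[i]) :
  normc (\prod_(i <- r | P i) F i) = \prod_(i <- r | P i) normc (F i).
Proof. exact: (big_morph _ (@normcM R) (@normc1 R)). Qed.

Lemma ler_normc_sum (R : realType) (I : Type) (r : seq I) (P : pred I)
    (F : I -> R[i]) :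
  normc (\sum_(i <- r | P i) F i) <= \sum_(i <- r | P i) normc (F i).
Proof.
elim/big_ind2: _ => // [|x1 x2 y1 y2 h1 h2]; first by rewrite normc0.
by apply: le_trans (le_normcD _ _) _; exact: lerD.
Qed.

Lemma normcB (R : realType) (x y : R[i]) : normc (x - y) = normc (y - x).
Proof. by rewrite -normcN opprB. Qed.

Lemma ler_normcB (R : realType) (y x z : R[i]) :
  normc (x - z) <= normc (x - y) + normc (y - z).
Proof. by rewrite -[x - z](subrKA y); exact: le_normcD. Qed.

Lemma normr_Re_le (R : realType) (z : R[i]) : `|complex.Re z| <= normc z.
Proof.
case: z => a b /=; rewrite -sqrtr_sqr ler_wsqrtr // lerDl sqr_ge0 //.
Qed.

Lemma normr_Im_le (R : realType) (z : R[i]) : `|complex.Im z| <= normc z.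
Proof.
case: z => a b /=; rewrite -sqrtr_sqr ler_wsqrtr // lerDr sqr_ge0 //.
Qed.

Lemma normc_le_ReIm (R : realType) (z : R[i]) :
  normc z <= `|complex.Re z| + `|complex.Im z|.
Proof.
case: z => a b.
rewrite [X in normc X]complexE.
apply: le_trans (le_normcD _ _) _; rewrite normcM !normc_real.
by rewrite /= expr0n /= expr1n add0r sqrtr1 mul1r.
Qed.

(** The topology of [R[i]^o] is indexed by positive elements of [R[i]]; these
are exactly the embedded positive reals, so real radii suffice. *)
Lemma cvg_normcP (R : realType) (T : Type) (F : set_system T) {FF : Filter F}
    (f : T -> R[i]^o) (l : R[i]^o) :
  f @ F --> l <-> forall e : R, 0 < e -> \forall t \near F, normc (l - f t) < e.
Proof.
split=> [/cvgrPdist_lt h e e0|h].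
  have := h e%:C; rewrite ltcR => /(_ e0).
  by apply: filterS => t; rewrite normC_normc ltcR.
apply/cvgrPdist_lt => e; rewrite ltcE => /andP[/eqP ime ree].
have -> : e = (complex.Re e)%:C by case: e ime {ree} => a b /= ->.
by apply: filterS (h _ ree) => t; rewrite normC_normc ltcR.
Qed.

(** Completeness of [R[i]]: the real and imaginary parts are Cauchy. *)
Lemma cvg_normc_cauchy (R : realType) (T : Type) (F : set_system T)
    {FF : ProperFilter F} (f : T -> R[i]^o) :
  (forall e : R, 0 < e ->
     exists z : R[i], \forall t \near F, normc (z - f t) < e) ->
  cvg (f @ F).
Proof.
move=> h.
have part (g : R[i] -> R) :
    (forall z w, g (z - w) = g z - g w) -> (forall z, `|g z| <= normc z) ->
    exists l : R, (g \o f) @ F --> l.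
  move=> gB gle.
  suff : cvg ((g \o f) @ F) by move=> c; exists (lim ((g \o f) @ F)).
  apply/cauchy_cvgP; apply: cauchy_exP => e e0.
  have [z hz] := h e e0; exists (g z).
  apply: filterS hz => t; rewrite /ball /= => /(le_lt_trans _); apply.
  by rewrite -gB.
have ReB (z w : R[i]) : complex.Re (z - w) = complex.Re z - complex.Re w.
  by case: z w => ? ? [].
have ImB (z w : R[i]) : complex.Im (z - w) = complex.Im z - complex.Im w.
  by case: z w => ? ? [].
have [a /cvgrPdist_lt ha] := part _ ReB (@normr_Re_le R).
have [b /cvgrPdist_lt hb] := part _ ImB (@normr_Im_le R).
apply/cvg_ex; exists (a +i* b); apply/cvg_normcP => e e0.
have e20 : 0 < e / 2 by rewrite divr_gt0.
apply: filterS2 (ha _ e20) (hb _ e20) => t h1 h2.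
apply: le_lt_trans (normc_le_ReIm _) _.
by rewrite ReB ImB [e]splitr; exact: ltrD.
Qed.

(** Finite partial sums of an absolutely summable family stay close to the one
over a finite set that nearly exhausts the supremum of the absolute sums. *)
Lemma cvg_partial_sum_abs (R : realType) (I : choiceType) (a : I -> R[i]^o)
    (M : R) :
  (forall A : {fset I}, \sum_(i <- A) normc (a i) <= M) ->
  cvg (partial_sum a @ totally).
Proof.
move=> hM; apply: (@cvg_normc_cauchy _ _ _ (@totally_filter I)) => e e0.
pose S := [set \sum_(i <- A) normc (a i) | A in [set: {fset I}]].
have hS : has_sup S.
  split; first by exists (\sum_(i <- fset0) normc (a i)), fset0.
  by exists M => _ [A _ <-].
have [_ [A _ <-] hA] := sup_adherent e0 hS.
(* the part of a larger set [B] lying outside [A] has absolute sum below [e] *)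
exists (partial_sum a A); exists A => // B /= AB.
have AE : [fset i in B | i \in A]%fset = A.
  by apply/fsetP => i; rewrite !inE andbC andb_idr // => /(fsubsetP AB).
have split_sum (V : zmodType) (g : I -> V) : \sum_(i <- B) g i =
    \sum_(i <- A) g i + \sum_(i <- [fset i in B | i \notin A]%fset) g i.
  by rewrite (big_fsetID _ (mem A) B) /= AE.
have hB : \sum_(i <- B) normc (a i) <= sup S.
  by apply: sup_ubound; [exact: hS.2 | exists B].
rewrite /partial_sum -!(big_seq_fsetE _ _ xpredT a) split_sum.
rewrite normcB [X in normc X]addrC addKr.
apply: le_lt_trans (ler_normc_sum _ _ _) _.
move: hB hA; rewrite split_sum; lra.
Qed.

(** The tail beyond an index whose partial sum nearly attains the supremum is
small. *)
Lemma bounded_series_cauchy (R : realType) (a : nat -> R) (M e : R) :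
  (forall n, 0 <= a n) -> (forall N, \sum_(0 <= n < N) a n <= M) -> 0 < e ->
  exists n, forall m, (n <= m)%N -> \sum_(n <= i < m) a i < e.
Proof.
move=> a0 hM e0.
pose S := [set \sum_(0 <= i < n) a i | n in [set: nat]].
have hS : has_sup S.
  split; first by exists (\sum_(0 <= i < 0) a i), 0%N.
  by exists M => _ [A _ <-].
have [_ [n _ <-] hn] := sup_adherent e0 hS.
exists n => m nm.
have : \sum_(0 <= i < m) a i <= sup S.
  by apply: sup_ubound; [exact: hS.2 | exists m].
move: hn; rewrite (big_cat_nat (leq0n n) nm) //=; lra.
Qed.

Lemma prod_le_expR (R : realType) (a u : nat -> R) (N : nat) :
  (forall n, 0 <= u n <= 1 + a n) ->
  \prod_(0 <= n < N) u n <= expR (\sum_(0 <= n < N) a n).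
Proof.
move=> h; elim: N => [|N IH]; first by rewrite !big_nil expR0.
have p0 : 0 <= \prod_(0 <= n < N) u n.
  by apply: prodr_ge0 => i _; case/andP: (h i).
rewrite !big_nat_recr //= expRD; apply: ler_pM => //.
  by case/andP: (h N).
by case/andP: (h N) => _ /le_trans; apply; exact: expR_ge1Dx.
Qed.

(** Partial products of factors [u n] with [\sum |u n - 1|] finite are bounded,
so their increments [P_n (u n - 1)] are summable. *)
Lemma cvgn_prod_normc (R : realType) (u : nat -> R[i]) (a : nat -> R) (M : R) :
  (forall n, normc (u n - 1) <= a n) ->
  (forall N, \sum_(0 <= n < N) a n <= M) ->
  cvgn ((fun N => \prod_(0 <= n < N) u n) : nat -> R[i]^o).
Proof.
move=> ha hM.
have a0 n : 0 <= a n by apply: le_trans (ha n); exact: normc_ge0.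
pose P N := \prod_(0 <= n < N) u n.
have Pb N : normc (P N) <= expR M.
  rewrite /P normc_prod; apply: le_trans (_ : expR (\sum_(0 <= n < N) a n) <= _).
    apply: prod_le_expR => n; rewrite normc_ge0 /=.
    rewrite -[u n](subrK 1); apply: le_trans (le_normcD _ _) _.
    by rewrite normc1 addrC lerD2l.
  by rewrite ler_expR.
apply: cvg_normc_cauchy => e e0.
have [n hn] := bounded_series_cauchy a0 hM (divr_gt0 e0 (expR_gt0 M)).
exists (P n); exists n => // m /= nm; rewrite normcB.
suff : normc (P m - P n) <= expR M * \sum_(n <= i < m) a i.
  by move=> /le_lt_trans; apply; rewrite mulrC -ltr_pdivlMr ?expR_gt0 // hn.
elim: m nm => [|m IH].
  by rewrite leqn0 => /eqP ->; rewrite subrr normc0 big_nil mulr0.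
rewrite leq_eqVlt => /predU1P[<-|]; first by rewrite subrr normc0 big_geq // mulr0.
rewrite ltnS => nm; rewrite big_nat_recr //= mulrDr.
apply: le_trans (ler_normcB (P m) _ _) _; rewrite addrC lerD ?IH //.
have -> : P m.+1 - P m = P m * (u m - 1) by rewrite /P big_nat_recr //= mulrBr mulr1.
by rewrite normcM ler_pM ?normc_ge0.
Qed.

(** The estimate of the sum is proved with a truncated product in place of the
Euler product; this lets the truncations tend to infinity. *)
Lemma normc_cvg_le (R : realType) (T : Type) (F : set_system T)
    {FF : ProperFilter F} (f : T -> R[i]^o) (l : R[i]^o) (a c : R[i]) (B : R) :
  f @ F --> l -> (\forall t \near F, normc (a - c * f t) <= B) ->
  normc (a - c * l) <= B.
Proof.
move=> /cvg_normcP fl hB; apply/ler_addgt0Pr => e e0.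
have c0 : 0 < normc c + 1 by rewrite ltr_wpDl ?normc_ge0.
have [t [h1 h2]] := filter_ex (filterI hB (fl _ (divr_gt0 e0 c0))).
apply: le_trans (ler_normcB (c * f t) _ _) _; apply: lerD h1 _.
rewrite -mulrBr normcM normcB.
apply: le_trans (_ : (normc c + 1) * (e / (normc c + 1)) <= _).
  by apply: ler_pM; rewrite ?normc_ge0 ?lerDl // ltW.
by rewrite mulrC divfK // gt_eqF.
Qed.

(** * Power sums over an interval *)

Lemma exprB_bounds (R : realType) (a b : R) (k : nat) : 0 <= b <= a ->
  k.+1%:R * b ^+ k * (a - b) <= a ^+ k.+1 - b ^+ k.+1
    <= k.+1%:R * a ^+ k * (a - b).
Proof.
move=> /andP[b0 ba]; have a0 := le_trans b0 ba.
have ab0 : 0 <= a - b by rewrite subr_ge0.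
have const c : k.+1%:R * c = \sum_(i < k.+1) c :> R.
  by rewrite sumr_const card_ord mulr_natl.
rewrite subrXX ![_ * (a - b)]mulrC !const; apply/andP.
split; apply: ler_wpM2l => //; apply: ler_sum => i _ /=.
  rewrite -{1}(@subnK i k) -1?ltnS // exprD.
  by rewrite ler_wpM2r ?exprn_ge0 // lerXn2r ?nnegrE.
have -> : a ^+ k = a ^+ (k - i) * a ^+ i by rewrite -exprD subnK -1?ltnS.
by rewrite ler_wpM2l ?exprn_ge0 // lerXn2r ?nnegrE.
Qed.

(** The function [(y^2 - t^2)^(k+1) / (2 (k+1))] is a primitive of
[- t (y^2 - t^2)^k]; the difference of its values at [m - 1] and [m] is
[m (y^2 - m^2)^k] up to [y^(2k) / 2], so the sum telescopes. *)
Lemma weighted_power_sum (R : realType) (k N : nat) (y : R) :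
  N%:R <= y < N.+1%:R ->
  `|\sum_(1 <= m < N.+1) m%:R * (y ^+ 2 - m%:R ^+ 2) ^+ k
    - (y ^+ 2) ^+ k.+1 / (2 * k.+1%:R)| <= 2 * ((y ^+ 2) ^+ k * y).
Proof.
move=> /andP[Ny yN].
have y0 : 0 <= y by apply: le_trans Ny; rewrite ler0n.
pose B m : R := y ^+ 2 - m%:R ^+ 2.
pose h m : R := B m ^+ k.+1 / (2 * k.+1%:R).
have B0 m : (m <= N)%N -> 0 <= B m.
  move=> mN; rewrite subr_ge0 lerXn2r ?nnegrE ?ler0n //.
  by apply: le_trans Ny; rewrite ler_nat.
have By m : B m <= y ^+ 2 by rewrite gerBl sqr_ge0.
have Bk m : (m <= N)%N -> B m ^+ k <= (y ^+ 2) ^+ k.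
  by move=> mN; rewrite lerXn2r ?nnegrE ?sqr_ge0 ?B0.
have BS m : B m - B m.+1 = 2 * m%:R + 1 by rewrite /B -natr1; ring.
have k0 : (0 : R) < k.+1%:R by rewrite ltr0n.
have hb m : (m < N)%N ->
    (m%:R + 2^-1) * B m.+1 ^+ k <= h m - h m.+1 <= (m%:R + 2^-1) * B m ^+ k.
  move=> mN.
  have := @exprB_bounds R (B m) (B m.+1) k.
  rewrite B0 // -subr_ge0 BS addr_ge0 ?mulr_ge0 ?ler0n // => /(_ isT) /andP[h1 h2].
  have E (c : R) : (m%:R + 2^-1) * c * (2 * k.+1%:R)
      = k.+1%:R * c * (2 * m%:R + 1) by field.
  by rewrite /h -mulrBl ler_pdivlMr ?ler_pdivrMr ?mulr_gt0 // !E h1.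
have hE : (y ^+ 2) ^+ k.+1 / (2 * k.+1%:R) = h 0%N.
  by rewrite /h /B expr0n subr0.
rewrite hE -[X in `|X - _|]/(\sum_(1 <= m < N.+1) m%:R * B m ^+ k).
have S0 n : \sum_(0 <= m < n.+1) m%:R * B m ^+ k
    = \sum_(1 <= m < n.+1) m%:R * B m ^+ k.
  by rewrite big_nat_recl // big_add1 mul0r add0r.
have up n : (n <= N)%N -> \sum_(1 <= m < n.+1) m%:R * B m ^+ k
     <= h 0%N - h n + n%:R / 2 * (y ^+ 2) ^+ k.
  elim: n => [|n IH] nN; first by rewrite big_geq // subrr !mul0r addr0.
  rewrite big_nat_recr //=; have := IH (ltnW nN).
  have /andP[+ _] := hb _ nN; have := Bk _ nN; rewrite -[n.+1%:R]natr1.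
  move: (\sum_(_ <= _ < _) _) (h _) (h _) (h _) (B _ ^+ k) ((y ^+ 2) ^+ k) => *. lra.
have lo n : (n <= N)%N -> h 0%N - h n <= \sum_(0 <= m < n) m%:R * B m ^+ k
     + n%:R / 2 * (y ^+ 2) ^+ k.
  elim: n => [|n IH] nN; first by rewrite big_geq // subrr !mul0r addr0.
  rewrite big_nat_recr //=; have := IH (ltnW nN).
  have /andP[_ +] := hb _ nN; have := Bk _ (ltnW nN); rewrite -[n.+1%:R]natr1.
  by move: (\sum_(_ <= _ < _) _) (h _) (h _) (h _) (B _ ^+ k) ((y ^+ 2) ^+ k) => *; lra.
have yk0 : 0 <= (y ^+ 2) ^+ k by rewrite exprn_ge0 ?sqr_ge0.
have hN0 : 0 <= h N by rewrite divr_ge0 ?exprn_ge0 ?B0 // mulr_ge0 // ltW.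
have BN : B N <= 2 * y.
  have -> : B N = (y - N%:R) * (y + N%:R) by rewrite /B; ring.
  rewrite -[N.+1%:R]natr1 in yN; have -> : 2 * y = y + y by ring.
  apply: le_trans (_ : 1 * (y + N%:R) <= _); last by rewrite mul1r lerD2l.
  by apply: ler_pM; rewrite ?subr_ge0 ?addr_ge0 ?ler0n //; lra.
(* the telescoped sum stops at [N], where [y^2 - N^2 <= 2 y] since [y < N + 1] *)
have hN : h N <= (y ^+ 2) ^+ k * y.
  rewrite /h ler_pdivrMr ?mulr_gt0 // exprS mulrC.
  apply: le_trans (_ : (y ^+ 2) ^+ k * (2 * y) <= _).
    by apply: ler_pM; rewrite ?exprn_ge0 ?B0 ?Bk.
  have -> : (y ^+ 2) ^+ k * y * (2 * k.+1%:R) = (y ^+ 2) ^+ k * (2 * y) * k.+1%:R.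
    by ring.
  by rewrite ler_peMr ?ler1n // mulr_ge0 // mulr_ge0.
have NyK : N%:R / 2 * (y ^+ 2) ^+ k <= 2^-1 * ((y ^+ 2) ^+ k * y).
  by rewrite [leRHS]mulrCA mulrC ler_wpM2l // mulrC ler_wpM2l.
have s0 : \sum_(0 <= m < N) m%:R * B m ^+ k <= \sum_(1 <= m < N.+1) m%:R * B m ^+ k.
  by rewrite -S0 big_nat_recr //= lerDl mulr_ge0 ?exprn_ge0 ?B0.
have := up N (leqnn _); have := lo N (leqnn _).
have : 0 <= (y ^+ 2) ^+ k * y by rewrite mulr_ge0.
by rewrite ler_norml => *; apply/andP; split; lra.
Qed.

Lemma sum_nat_le_sqr (N : nat) : (\sum_(1 <= m < N.+1) m <= N ^ 2)%N.
Proof.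
elim: N => [|N IH]; first by rewrite big_geq.
rewrite big_nat_recr //=; apply: leq_trans (leq_add IH (leqnn _)) _.
by rewrite -[in leqRHS]addn1 sqrnD muln1 exp1n -addnA leq_add2l addnC addn1 ltnS
  mul2n -addnn leq_addr.
Qed.

(** A condition on multiples [a = d m] becomes a range for [m], ending at the
integer part of [sqrt x / d]; the bound [M] only makes the index type finite. *)
Lemma big_multiples (R : realType) (V : nmodType) (d M : nat) (x : R)
    (F : nat -> V) :
  (0 < d)%N -> 0 <= x -> (forall m : nat, (m ^ 2)%:R <= x -> (m < M)%N) ->
  exists2 N : nat, N%:R <= Num.sqrt x / d%:R < N.+1%:R &
    \sum_(a < M | [&& (0 < a)%N, (d %| a)%N & (a ^ 2)%:R <= x]) F a
    = \sum_(1 <= m < N.+1) F (d * m)%N.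
Proof.
move=> d0 x0 hM.
have y0 : 0 <= Num.sqrt x / d%:R by rewrite divr_ge0 ?sqrtr_ge0.
have /andP[N1 N2] := truncn_itv y0.
set N := Num.truncn _ in N1 N2.
exists N; first by rewrite N1.
have sq (m : nat) : ((d * m) ^ 2)%:R <= x = (m <= N)%N.
  have -> : (((d * m) ^ 2)%:R <= x) = (m%:R <= Num.sqrt x / d%:R).
    rewrite ler_pdivlMr ?ltr0n // -natrM mulnC natrX -[in LHS](sqr_sqrtr x0).
    by rewrite ler_sqr ?nnegrE ?sqrtr_ge0.
  apply/idP/idP => h; last by apply: le_trans N1; rewrite ler_nat.
  by rewrite -ltnS -(ltr_nat R); exact: le_lt_trans N2.
rewrite -(big_mkord (fun a => [&& (0 < a)%N, (d %| a)%N & (a ^ 2)%:R <= x]) F).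
rewrite -big_filter -(big_map (fun m => d * m)%N xpredT F).
apply: perm_big; apply: uniq_perm.
- by rewrite filter_uniq ?iota_uniq.
- rewrite map_inj_uniq ?iota_uniq // => a b /eqP.
  by rewrite eqn_pmul2l // => /eqP.
move=> a; rewrite mem_filter mem_index_iota; apply/idP/mapP.
  case/andP=> /and3P[a0 /dvdnP[m am] ax] _; exists m; last by rewrite mulnC.
  rewrite mem_index_iota; move: ax; rewrite am mulnC sq => mN.
  by rewrite ltnS mN andbT; move: a0; rewrite am muln_gt0 => /andP[].
case=> m; rewrite mem_index_iota ltnS => /andP[m0 mN] ->.
by rewrite muln_gt0 d0 m0 dvdn_mulr //= sq mN /= hM // sq.
Qed.

(** * Weighted lattice sums over ellipsoids *)

Definition ffun_cons (T : finType) (k : nat) (a : T) (n : {ffun 'I_k -> T}) :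
    {ffun 'I_k.+1 -> T} :=
  [ffun i => if unlift ord0 i is Some j then n j else a].

Lemma ffun_cons0 (T : finType) (k : nat) (a : T) (n : {ffun 'I_k -> T}) :
  ffun_cons a n ord0 = a.
Proof. by rewrite ffunE unlift_none. Qed.

Lemma ffun_consS (T : finType) (k : nat) (a : T) (n : {ffun 'I_k -> T}) j :
  ffun_cons a n (lift ord0 j) = n j.
Proof. by rewrite ffunE liftK. Qed.

Lemma big_ffun_recl (V : nmodType) (T : finType) (k : nat)
    (P : pred {ffun 'I_k.+1 -> T}) (F : {ffun 'I_k.+1 -> T} -> V) :
  \sum_(n | P n) F n
    = \sum_(a : T) \sum_(n : {ffun 'I_k -> T} | P (ffun_cons a n))
        F (ffun_cons a n).
Proof.
rewrite pair_big_dep /=.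
rewrite (reindex (fun u : T * {ffun 'I_k -> T} => ffun_cons u.1 u.2)) //=.
exists (fun n => (n ord0, [ffun j => n (lift ord0 j)])) => [[a n] _|n _] /=.
  by rewrite ffun_cons0; congr (_, _); apply/ffunP => j; rewrite ffunE ffun_consS.
apply/ffunP => i; case: (unliftP ord0 i) => [j|] ->.
  by rewrite ffun_consS ffunE.
by rewrite ffun_cons0.
Qed.

(** In terms of [m_i = n_i / d_i] this is the sum of [\prod m_i] over the positive
[m] with [\sum (d_i m_i)^2 <= x]; it is indexed by [n] because it arises by
exchanging a sum over [n] with a sum over divisors of the [n_i].  The bound [M]
only makes the index type finite. *)
Definition lattice_sum (R : realType) (M k : nat) (d : 'I_k -> nat) (x : R) : R :=
  \sum_(n : {ffun 'I_k -> 'I_M} |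
        [forall i, (0 < n i)%N && (d i %| n i)%N]
        && ((\sum_(i < k) n i ^ 2)%N%:R <= x))
    \prod_(i < k) (n i %/ d i)%N%:R.

Lemma lattice_sum_recl (R : realType) (M k : nat) (d : 'I_k.+1 -> nat) (x : R) :
  lattice_sum M d x
  = \sum_(a < M | [&& (0 < a)%N, (d ord0 %| a)%N & (a ^ 2)%:R <= x])
      (a %/ d ord0)%N%:R
      * lattice_sum M (fun j => d (lift ord0 j)) (x - (a ^ 2)%:R).
Proof.
rewrite /lattice_sum big_ffun_recl /= [RHS]big_mkcond /=.
apply: eq_bigr => a _.
have sumE (n : {ffun 'I_k -> 'I_M}) :
    ((\sum_(i < k.+1) ffun_cons a n i ^ 2)%N%:R <= x)
    = ((\sum_(i < k) n i ^ 2)%N%:R <= x - (a ^ 2)%:R).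
  rewrite big_ord_recl ffun_cons0 natrD addrC -lerBrDr.
  by under eq_bigr do rewrite ffun_consS.
have allE (n : {ffun 'I_k -> 'I_M}) :
    [forall i, (0 < ffun_cons a n i)%N && (d i %| ffun_cons a n i)%N]
    = [&& (0 < a)%N, (d ord0 %| a)%N
        & [forall i, (0 < n i)%N && (d (lift ord0 i) %| n i)%N]].
  apply/forallP/and3P => [h|[h1 h2 /forallP h3] i].
    split; [| |apply/forallP => j].
    - by case/andP: (h ord0); rewrite ffun_cons0.
    - by case/andP: (h ord0); rewrite ffun_cons0.
    - by have := h (lift ord0 j); rewrite ffun_consS.
  by case: (unliftP ord0 i) => [j|] ->; rewrite ?ffun_consS ?ffun_cons0 ?h1.
under eq_bigl do rewrite allE sumE.
case: ifP => [/and3P[-> -> ax] /=|hn].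
  rewrite big_distrr /=; apply: eq_bigr => n _.
  rewrite big_ord_recl ffun_cons0; congr (_ * _).
  by apply: eq_bigr => j _; rewrite ffun_consS.
apply: big_pred0 => n; apply/negbTE/negP => /andP[/and3P[h1 h2 _] h3].
move: hn; rewrite h1 h2 /= => /negP; apply.
by rewrite -subr_ge0; apply: le_trans h3; rewrite ler0n.
Qed.

Lemma lattice_sum_ge0 (R : realType) (M k : nat) (d : 'I_k -> nat) (x : R) :
  0 <= lattice_sum M d x.
Proof.
by apply: sumr_ge0 => n _; apply: prodr_ge0 => i _; rewrite ler0n.
Qed.

Lemma weight_sum_le (R : realType) (M d : nat) (x : R) :
  (0 < d)%N -> 0 <= x -> (forall m : nat, (m ^ 2)%:R <= x -> (m < M)%N) ->
  \sum_(a < M | [&& (0 < a)%N, (d %| a)%N & (a ^ 2)%:R <= x]) (a %/ d)%N%:R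
  <= x / d%:R ^+ 2.
Proof.
move=> d0 x0 hM.
have [N /andP[Ny _] ->] := big_multiples (fun a => (a %/ d)%N%:R : R) d0 x0 hM.
under eq_bigr do rewrite mulKn //.
rewrite -natr_sum; apply: le_trans (_ : (N ^ 2)%:R <= _).
  by rewrite ler_nat sum_nat_le_sqr.
rewrite natrX -[x in leRHS]sqr_sqrtr // -expr_div_n.
by rewrite lerXn2r ?nnegrE ?divr_ge0 ?sqrtr_ge0.
Qed.

(** Here the coordinates are decoupled: each of them contributes at most
[x / d_i^2] once the others are bounded with the full [x]. *)
Lemma lattice_sum_le (R : realType) (M k : nat) (d : 'I_k -> nat) (x : R) :
  (forall i, (0 < d i)%N) -> 0 <= x ->
  (forall m : nat, (m ^ 2)%:R <= x -> (m < M)%N) ->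
  lattice_sum M d x <= x ^+ k / (\prod_(i < k) d i)%N%:R ^+ 2.
Proof.
elim: k d x => [|k IH] d x d0 x0 hM.
  rewrite big_ord0 !expr0 expr1n divr1 /lattice_sum.
  apply: le_trans (_ : \sum_(n : {ffun 'I_0 -> 'I_M}) 1 <= _).
    rewrite [leLHS]big_mkcond /=; apply: ler_sum => n _.
    by case: ifP => _; rewrite ?big_ord0 ?ler01.
  by rewrite sumr_const card_ffun !card_ord expn0.
rewrite lattice_sum_recl.
set Q := (\prod_(i < k) d (lift ord0 i))%N.
apply: le_trans (_ : \sum_(a < M | [&& (0 < a)%N, (d ord0 %| a)%N & (a ^ 2)%:R <= x])
    (a %/ d ord0)%N%:R * (x ^+ k / Q%:R ^+ 2) <= _).
  apply: ler_sum => a /and3P[_ _ ax]; apply: ler_wpM2l => //.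
  apply: le_trans (IH _ _ _ _ _) _ => //; rewrite ?subr_ge0 //.
    by move=> m mx; apply: hM; apply: le_trans mx _; rewrite gerBl ler0n.
  apply: ler_wpM2r; first by rewrite invr_ge0 exprn_ge0.
  by rewrite lerXn2r ?nnegrE ?subr_ge0 // gerBl ler0n.
rewrite -big_distrl /=.
apply: le_trans (ler_wpM2r _ (weight_sum_le (d0 ord0) x0 hM)) _.
  by rewrite divr_ge0 ?exprn_ge0.
rewrite big_ord_recl -/Q natrM exprMn [x ^+ k.+1]exprS [in leRHS]invfM.
by rewrite mulrACA.
Qed.

(** Summation over one coordinate at a time: the main terms
[x^k / (2^k k! \prod d_i^2)] are reproduced by [weighted_power_sum], each
coordinate contributing its own error.  The constant [2] does not grow with [k]:
an error inherited from the other coordinates is multiplied by at most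
[x / d_0^2], and the new one is proportional to [d_0]. *)
Lemma lattice_sum_asymp (R : realType) (M k : nat) (d : 'I_k -> nat) (x : R) :
  (forall i, (0 < d i)%N) -> 0 <= x ->
  (forall m : nat, (m ^ 2)%:R <= x -> (m < M)%N) ->
  `|lattice_sum M d x
    - x ^+ k / ((2 ^ k * k`!)%N%:R * (\prod_(i < k) d i)%N%:R ^+ 2)|
  <= 2 * (x ^+ k.-1 * Num.sqrt x) * (\sum_(i < k) d i)%N%:R
     / (\prod_(i < k) d i)%N%:R ^+ 2.
Proof.
elim: k d x => [|k IH] d x d0 x0 hM.
  rewrite !big_ord0 !expr0 expr1n mulr1 divr1 mulr0 mul0r /lattice_sum.
  have M0 : (0 < M)%N by apply: (hM 0%N); rewrite exp0n.
  rewrite (big_pred1 [ffun => Ordinal M0]); last first.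
    move=> n /=; rewrite !big_ord0 x0 andbT.
    apply/forallP/eqP => [_|_ []//].
    by apply/ffunP => -[].
  by rewrite big_ord0 subrr normr0.
rewrite lattice_sum_recl.
set Q := (\prod_(i < k) d (lift ord0 i))%N.
set e := (\sum_(i < k) d (lift ord0 i))%N.
set c : R := (2 ^ k * k`!)%N%:R.
have c0 : 0 < c by rewrite ltr0n muln_gt0 expn_gt0 fact_gt0.
have c1 : 1 <= c by rewrite ler1n muln_gt0 expn_gt0 fact_gt0.
have Qn0 : (0 < Q)%N by rewrite prodn_gt0.
have Qr0 : 0 < Q%:R :> R by rewrite ltr0n.
have Q0 : 0 < Q%:R ^+ 2 :> R by rewrite exprn_gt0 // ltr0n.
have D0 : 0 < (d ord0)%:R :> R by rewrite ltr0n.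
have s0 := sqrtr_ge0 x.
pose P a := [&& (0 < a)%N, (d ord0 %| a)%N & ((a ^ 2)%:R <= x)].
rewrite -[\sum_(a < M | _) _]/(\sum_(a < M | P a) _).
pose main := \sum_(a < M | P a)
   (a %/ d ord0)%N%:R * (x - (a ^ 2)%:R) ^+ k / (c * Q%:R ^+ 2).
(* the error inherited from the remaining coordinates *)
have step1 : `|\sum_(a < M | P a) (a %/ d ord0)%N%:R
      * lattice_sum M (fun j => d (lift ord0 j)) (x - (a ^ 2)%:R) - main|
    <= x / (d ord0)%:R ^+ 2
       * (2 * (x ^+ k.-1 * Num.sqrt x) * e%:R / Q%:R ^+ 2).
  rewrite -sumrB; apply: le_trans (ler_norm_sum _ _ _) _.
  apply: le_trans (_ : \sum_(a < M | P a) (a %/ d ord0)%N%:R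
       * (2 * (x ^+ k.-1 * Num.sqrt x) * e%:R / Q%:R ^+ 2) <= _); last first.
    rewrite -big_distrl /=; apply: ler_wpM2r; last exact: weight_sum_le.
    by rewrite divr_ge0 ?mulr_ge0 ?exprn_ge0.
  apply: ler_sum => a /and3P[_ _ ax].
  rewrite -mulrA -mulrBr normrM ger0_norm //; apply: ler_wpM2l => //.
  have xa0 : 0 <= x - (a ^ 2)%:R by rewrite subr_ge0.
  have xa : x - (a ^ 2)%:R <= x by rewrite gerBl.
  apply: le_trans (IH _ _ _ xa0 _) _ => //.
    by move=> m mx; apply: hM; exact: le_trans mx _.
  apply: ler_wpM2r; first by rewrite invr_ge0 ltW.
  apply: ler_wpM2r => //; apply: ler_wpM2l => //.
  by apply: ler_pM; rewrite ?exprn_ge0 ?sqrtr_ge0 ?ler_wsqrtr // lerXn2r ?nnegrE.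
(* the error of the one-dimensional sum *)
have step2 : `|main - x ^+ k.+1 / ((2 ^ k.+1 * k.+1`!)%N%:R
       * ((d ord0)%:R * Q%:R) ^+ 2)|
    <= 2 * (x ^+ k * Num.sqrt x / (d ord0)%:R) / Q%:R ^+ 2.
  have [N Ny sumE] := big_multiples
    (fun a => (a %/ d ord0)%N%:R * (x - (a ^ 2)%:R) ^+ k / (c * Q%:R ^+ 2) : R)
    (d0 ord0) x0 hM.
  rewrite /main sumE; have := weighted_power_sum k Ny.
  set y := _ / _; set s := \sum_(_ <= _ < _) _ => hs.
  have y2 : y ^+ 2 = x / (d ord0)%:R ^+ 2 by rewrite expr_div_n sqr_sqrtr.
  have sE : \sum_(1 <= m < N.+1) ((d ord0 * m) %/ d ord0)%N%:R
        * (x - ((d ord0 * m) ^ 2)%:R) ^+ k / (c * Q%:R ^+ 2)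
      = s * ((d ord0)%:R ^+ 2) ^+ k / (c * Q%:R ^+ 2).
    rewrite /s -mulrA mulr_suml; apply: eq_bigr => m _; rewrite mulKn // -!mulrA.
    congr (_ * _); rewrite mulrA; congr (_ / _); rewrite -exprMn; congr (_ ^+ _).
    by rewrite y2 natrX natrM; field; rewrite gt_eqF.
  have mE : x ^+ k.+1 / ((2 ^ k.+1 * k.+1`!)%N%:R * ((d ord0)%:R * Q%:R) ^+ 2)
      = (y ^+ 2) ^+ k.+1 / (2 * k.+1%:R) * ((d ord0)%:R ^+ 2) ^+ k / (c * Q%:R ^+ 2).
    have -> : (2 ^ k.+1 * k.+1`!)%N%:R = 2 * k.+1%:R * c :> R.
      by rewrite /c expnS factS !natrM; ring.
    have -> : x = y ^+ 2 * (d ord0)%:R ^+ 2 by rewrite y2 divfK // gt_eqF ?exprn_gt0.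
    rewrite !exprMn ![_ ^+ k.+1]exprS; field.
    by rewrite nat1r !pnatr_eq0 -!lt0n Qn0 fact_gt0 expn_gt0 d0.
  rewrite sE mE -!mulrBl !normrM.
  rewrite normfV [Num.norm (c * _)]gtr0_norm ?mulr_gt0 //.
  rewrite [Num.norm (_ ^+ k)]ger0_norm ?exprn_ge0 ?sqr_ge0 // ler_pdivrMr ?mulr_gt0 //.
  apply: le_trans (ler_wpM2r _ hs) _; first by rewrite exprn_ge0 ?sqr_ge0.
  have -> : 2 * (x ^+ k * Num.sqrt x / (d ord0)%:R) / Q%:R ^+ 2 * (c * Q%:R ^+ 2)
     = c * (2 * (x ^+ k * y)) by rewrite /y; field; rewrite ?(gt_eqF c0) ?pnatr_eq0 -?lt0n ?Qn0 ?d0.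
  have -> : 2 * ((y ^+ 2) ^+ k * y) * ((d ord0)%:R ^+ 2) ^+ k = 2 * (x ^+ k * y).
    have -> : x = y ^+ 2 * (d ord0)%:R ^+ 2 by rewrite y2 divfK // gt_eqF ?exprn_gt0.
    by rewrite [in RHS]exprMn; move: ((y ^+ 2) ^+ k) (((d ord0)%:R ^+ 2) ^+ k) => u v; ring.
  by rewrite ler_peMl // !mulr_ge0 ?exprn_ge0 // divr_ge0 // ltW.
have xe : x * x ^+ k.-1 * e%:R = x ^+ k * e%:R :> R.
  rewrite /e; case: (k) (d) => [|j] d'.
    by rewrite big_ord0 !mulr0.
  by rewrite -exprS.
rewrite !big_ord_recl -/Q -/e (natrM _ (d ord0) Q) natrD.
apply: (le_trans (ler_distD main _ _)).
apply: le_trans (lerD step1 step2) _.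
rewrite le_eqVlt; apply/orP; left; apply/eqP.
have -> : x / (d ord0)%:R ^+ 2 * (2 * (x ^+ k.-1 * Num.sqrt x) * e%:R / Q%:R ^+ 2)
   = x * x ^+ k.-1 * e%:R * (2 * Num.sqrt x / ((d ord0)%:R ^+ 2 * Q%:R ^+ 2)).
  by field; rewrite !pnatr_eq0 -!lt0n Qn0 d0.
by rewrite xe; field; rewrite !pnatr_eq0 -!lt0n Qn0 d0.
Qed.

(** When [\prod d_i <= sqrt x] the error of [lattice_sum_asymp] is at most
[2 k \prod d_i / sqrt x] times [x^k / \prod d_i^2]; when [\prod d_i > sqrt x] both
the sum and the main term are at most [x^k / \prod d_i^2].  In either case the
ratio [\prod d_i / sqrt x] can be replaced by its power [theta]. *)
Lemma lattice_sum_interp (R : realType) (M k : nat) (d : 'I_k -> nat)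
    (x theta : R) :
  (0 < k)%N -> (forall i, (0 < d i)%N) -> 0 < x -> 0 <= theta <= 1 ->
  (forall m : nat, (m ^ 2)%:R <= x -> (m < M)%N) ->
  `|lattice_sum M d x
    - x ^+ k / ((2 ^ k * k`!)%N%:R * (\prod_(i < k) d i)%N%:R ^+ 2)|
  <= (2 * k)%N%:R
     * (x `^ (k%:R - theta / 2) * (\prod_(i < k) d i)%N%:R `^ (theta - 2)).
Proof.
move=> k0 d0 x0 /andP[t0 t1] hM.
set Q := (\prod_(i < k) d i)%N.
set c : R := (2 ^ k * k`!)%N%:R.
have Qn0 : (0 < Q)%N by rewrite prodn_gt0.
have Q0 : 0 < Q%:R :> R by rewrite ltr0n.
have s0 : 0 < Num.sqrt x by rewrite sqrtr_gt0.
pose r := Q%:R / Num.sqrt x.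
have r0 : 0 < r by rewrite divr_gt0.
have -> : x `^ (k%:R - theta / 2) * Q%:R `^ (theta - 2)
    = x ^+ k / Q%:R ^+ 2 * r `^ theta.
  rewrite !powRD ?(gt_eqF x0) ?(gt_eqF Q0) ?implybT //.
  rewrite powR_mulrn ?(ltW x0) // (@powRN _ Q%:R) powR_mulrn ?(ltW Q0) //.
  rewrite /r powRM ?invr_ge0 ?(ltW s0) ?(ltW Q0) //.
  have -> : (Num.sqrt x)^-1 `^ theta = x `^ (- (theta / 2)).
    rewrite -powR12_sqrt ?(ltW x0) // -powRN -powRrM; congr (_ `^ _).
    by rewrite mulNr mulrC.
  by ring.
have m0 : 0 < x ^+ k / Q%:R ^+ 2 by rewrite divr_gt0 ?exprn_gt0.
have k1 : 1 <= (2 * k)%N%:R :> R by rewrite ler1n muln_gt0.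
have [rle|rgt] := leP r 1; last first.
  have rt : 1 <= r `^ theta by rewrite -(powRr0 r) ler_powR // ltW.
  apply: le_trans (_ : x ^+ k / Q%:R ^+ 2 <= _); last first.
    apply: le_trans (_ : 1 * (x ^+ k / Q%:R ^+ 2 * 1) <= _).
      by rewrite mulr1 mul1r.
    by apply: ler_pM; rewrite ?mulr1 ?ler_peMr ?(ltW m0).
  have S0 := lattice_sum_ge0 M d x.
  have := lattice_sum_le d0 (ltW x0) hM; rewrite -/Q => S1.
  have c1 : 1 <= c by rewrite ler1n muln_gt0 expn_gt0 fact_gt0.
  have c0 : 0 < c by apply: lt_le_trans c1.
  have h0 : 0 <= x ^+ k / (c * Q%:R ^+ 2).
    by rewrite divr_ge0 ?mulr_ge0 ?exprn_ge0 // ltW.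
  have h1 : x ^+ k / (c * Q%:R ^+ 2) <= x ^+ k / Q%:R ^+ 2.
    rewrite ler_wpM2l ?exprn_ge0 ?(ltW x0) //.
    by rewrite lef_pV2 ?posrE ?mulr_gt0 ?exprn_gt0 // ler_peMl ?exprn_ge0 ?(ltW Q0).
  by rewrite ler_norml; apply/andP; split; lra.
apply: le_trans (lattice_sum_asymp d0 (ltW x0) hM) _; rewrite -/Q.
have rr : r <= r `^ theta.
  by rewrite -[leLHS]powRr1 ?ger_powR ?r0 // ltW.
apply: le_trans (_ : (2 * k)%N%:R * (x ^+ k / Q%:R ^+ 2 * r) <= _); last first.
  by rewrite !ler_wpM2l // ltW.
have -> : (2 * k)%N%:R * (x ^+ k / Q%:R ^+ 2 * r)
    = 2 * (x ^+ k.-1 * Num.sqrt x) * (k * Q)%N%:R / Q%:R ^+ 2.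
  have -> : x ^+ k = x ^+ k.-1 * Num.sqrt x ^+ 2.
    by rewrite sqr_sqrtr ?(ltW x0) // -exprSr prednK.
  by rewrite /r !natrM; field; rewrite !gt_eqF.
apply: ler_wpM2r; first by rewrite invr_ge0 exprn_ge0.
apply: ler_wpM2l; first by rewrite !mulr_ge0 ?exprn_ge0 // ltW.
rewrite ler_nat -[k in leqRHS]card_ord -sum_nat_const; apply: leq_sum => i _.
by rewrite /Q (bigD1 i) //= leq_pmulr // prodn_gt0.
Qed.

(** * Sums of powers *)

Lemma geometric_sum_le (R : realType) (r : R) (n : nat) : 0 <= r < 1 ->
  \sum_(j < n) r ^+ j <= (1 - r)^-1.
Proof.
move=> /andP[r0 r1]; have r1' : 0 < 1 - r by rewrite subr_gt0.
rewrite -[leRHS]mul1r ler_pdivlMr // mulrC.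
have -> : \sum_(j < n) r ^+ j = \sum_(j < n) 1 ^+ (n.-1 - j) * r ^+ j.
  by apply: eq_bigr => j _; rewrite expr1n mul1r.
by rewrite -subrXX expr1n gerBl exprn_ge0.
Qed.

(** The terms of the dyadic block from [2^J] to [2^(J+1) - 1] add up to at most
[2^J (2^J)^-(1 + dl) = (2^-dl)^J], and these bounds form a geometric series. *)
Lemma bounded_sum_powRN (R : realType) (dl : R) : 0 < dl ->
  exists B : R, forall N, \sum_(0 <= n < N) n%:R `^ (- (1 + dl)) <= B.
Proof.
move=> dl0; pose a n : R := n%:R `^ (- (1 + dl)).
have a0 n : 0 <= a n by exact: powR_ge0.
pose r : R := 2 `^ (- dl).
have r0 : 0 < r by rewrite powR_gt0.
have r1 : r < 1.
  rewrite /r powRN invf_lt1 ?powR_gt0 //.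
  have : 1 `^ dl < (2 : R) `^ dl by rewrite gt0_ltr_powR ?nnegrE // ltr1n.
  by rewrite powR1.
exists (1 - r)^-1 => N.
have block J : \sum_(2 ^ J <= n < 2 ^ J.+1) a n <= r ^+ J.
  have J0 : (0 : R) < (2 ^ J)%N%:R by rewrite ltr0n expn_gt0.
  apply: le_trans (_ : \sum_(2 ^ J <= n < 2 ^ J.+1) a (2 ^ J)%N <= _).
    rewrite !big_seq; apply: ler_sum => n; rewrite mem_index_iota => /andP[h _].
    rewrite /a !powRN lef_pV2 ?posrE ?powR_gt0 //; last first.
      by apply: lt_le_trans J0 _; rewrite ler_nat.
    by rewrite ge0_ler_powR ?nnegrE ?ler_nat // addr_ge0 // ltW.
  rewrite sumr_const_nat expnS mul2n -addnn addnK /a opprD powRD; last first.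
    by rewrite (gt_eqF J0) implybT.
  rewrite powR_inv1 ?(ltW J0) // -[X in X <= _]mulr_natl mulrA mulfV ?gt_eqF // mul1r.
  by rewrite natrX /r -powR_mulrn // -powRrM mulrC powRrM powR_mulrn ?powR_ge0.
have dyadic J : \sum_(0 <= n < 2 ^ J) a n <= \sum_(0 <= j < J) r ^+ j.
  elim: J => [|J IH].
    rewrite big_nat1 big_geq // /a powR0 // oppr_eq0 gt_eqF //.
    by rewrite addr_gt0.
  rewrite (@big_cat_nat _ _ _ (2 ^ J)%N) //= ?leq_pexp2l //.
  by rewrite big_nat_recr //= lerD.
apply: le_trans (_ : \sum_(0 <= n < 2 ^ N) a n <= _).
  rewrite (@big_cat_nat _ _ _ N 0%N (2 ^ N)%N) //= ?(ltnW (ltn_expl _ _)) //.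
  by rewrite lerDl sumr_ge0.
apply: le_trans (dyadic N) _.
by rewrite big_mkord geometric_sum_le ?r1 ?ltW.
Qed.

(** * Division by a product of geometric series *)

(** For a function [H] on exponent tuples, the coefficients of the formal power
series [\prod_i (1 - c X_i) * \sum_nu H nu X^nu]. *)
Definition conv_inv (K : comNzRingType) (c : K) (k : nat)
    (H : {ffun 'I_k -> nat} -> K) (mu : 'I_k -> nat) : K :=
  \sum_(s : {ffun 'I_k -> bool})
    (\prod_(i < k) (if s i then - c * (0 < mu i)%N%:R else 1))
    * H [ffun i => (mu i - s i)%N].

Definition ffun_nat (E k : nat) (mu : {ffun 'I_k -> 'I_E}) : {ffun 'I_k -> nat} :=
  [ffun i => mu i : nat].

(** Multiplying back by [\prod_i 1 / (1 - c X_i)] recovers [H]: in each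
coordinate the two contributions to the coefficient of [H l] cancel unless
[l] is the full exponent. *)
Lemma conv_invK (K : comNzRingType) (c : K) (k E : nat)
    (H : {ffun 'I_k -> nat} -> K) (nu : {ffun 'I_k -> nat}) :
  (forall i, (nu i <= E)%N) ->
  \sum_(mu : {ffun 'I_k -> 'I_E.+1} | [forall i, (mu i <= nu i)%N])
     conv_inv c H (fun i => mu i) * \prod_(i < k) c ^+ (nu i - mu i)
  = H nu.
Proof.
move=> nuE.
(* [F i l m b] is the contribution of [mu i = m] and [s i = b] to the coefficient
   of [H] at exponents whose [i]th entry is [l] *)
pose F i (l m : nat) (b : bool) : K := (if b then - c * (0 < m)%N%:R else 1)
  * (c ^+ (nu i - m) * (m <= nu i)%N%:R) * (l == m - b)%N%:R.
have F1 i (l : nat) : (l <= E)%N ->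
    \sum_(m < E.+1) \sum_(b : bool) F i l m b = (l == nu i)%:R.
  move=> lE; rewrite exchange_big big_bool /=.
  have -> : \sum_(m < E.+1) F i l m false = (l <= nu i)%N%:R * c ^+ (nu i - l).
    rewrite (bigD1 (Ordinal (lE : (l < E.+1)%N))) //= big1 ?addr0.
      by rewrite /F subn0 eqxx mulr1 mul1r mulrC.
    move=> m /eqP ml; rewrite /F subn0; case: eqP => [lm|]; last by rewrite mulr0.
    by case: ml; apply: val_inj.
  have -> : \sum_(m < E.+1) F i l m true = - (l < nu i)%N%:R * c ^+ (nu i - l).
    have F0 (m : 'I_E.+1) : (m != l.+1 :> nat) -> F i l m true = 0.
      move=> ml; rewrite /F; case: (val m) ml => [|j]; first by rewrite mulr0 !mul0r.
      rewrite subn1 /= eqSS eq_sym => /negbTE ->; by rewrite mulr0.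
    have [lnu|nul] := ltnP l (nu i); last first.
      rewrite oppr0 mul0r big1 // => m _.
      have [ml|/F0 //] := eqVneq (m : nat) l.+1.
      have nl : (l < nu i)%N = false by rewrite ltnNge nul.
      by rewrite /F ml nl !mulr0 mul0r.
    have lE' : (l.+1 < E.+1)%N by rewrite ltnS; apply: leq_trans (nuE i).
    rewrite (bigD1 (Ordinal lE')) //= big1 ?addr0 => [|m ml]; last first.
      by apply: F0; apply: contra ml => /eqP ml; apply/eqP/val_inj.
    rewrite /F /= lnu subn1 eqxx !mulr1 -[in RHS](subnSK lnu) exprS.
    by rewrite !mulNr mul1r.
  have [lt|gt|->] := ltngtP l (nu i).
  - by rewrite mulN1r mul1r addNr.
  - by rewrite oppr0 !mul0r addr0.
  - by rewrite subnn expr0 oppr0 mul0r mul1r add0r.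
have -> : H nu = \sum_(l : {ffun 'I_k -> 'I_E.+1})
    H (ffun_nat l) * \prod_(i < k) \sum_(m < E.+1) \sum_(b : bool) F i (l i) m b.
  pose l0 : {ffun 'I_k -> 'I_E.+1} := [ffun i => inord (nu i)].
  rewrite (bigD1 l0) //= [X in _ + X]big1 ?addr0 => [|l ll0].
    rewrite big1 ?mulr1 => [|i _]; last by rewrite F1 -1?ltnS // ffunE inordK ?eqxx ?ltnS.
    by congr H; apply/ffunP => i; rewrite !ffunE inordK ?ltnS.
  have [i li] : exists i, (l i != nu i :> nat).
    apply/existsP; apply: contraNT ll0 => /existsPn h; apply/eqP/ffunP => i.
    by apply: val_inj; rewrite ffunE /= inordK ?ltnS //; have /negPn/eqP := h i.
  by rewrite (bigD1 i) //= F1 -1?ltnS // (negbTE li) mul0r mulr0.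
have expand (l : {ffun 'I_k -> 'I_E.+1}) :
    \prod_(i < k) \sum_(m < E.+1) \sum_(b : bool) F i (l i) m b
    = \sum_(mu : {ffun 'I_k -> 'I_E.+1}) \sum_(s : {ffun 'I_k -> bool})
        \prod_(i < k) F i (l i) (mu i) (s i).
  by rewrite bigA_distr_bigA; apply: eq_bigr => mu _; rewrite bigA_distr_bigA.
under [RHS]eq_bigr do rewrite expand mulr_sumr.
rewrite exchange_big [LHS]big_mkcond /=; apply: eq_bigr => mu _.
under [RHS]eq_bigr do rewrite mulr_sumr.
rewrite exchange_big /=.
have pick (s : {ffun 'I_k -> bool}) :
    \sum_(l : {ffun 'I_k -> 'I_E.+1})
      H (ffun_nat l) * \prod_(i < k) F i (l i) (mu i) (s i)
    = H [ffun i => (mu i - s i)%N] *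
      ((\prod_(i < k) (if s i then - c * (0 < mu i)%N%:R else 1)) *
      \prod_(i < k) (c ^+ (nu i - mu i) * (mu i <= nu i)%N%:R)).
  have ms i : (mu i - s i < E.+1)%N by apply: leq_ltn_trans (leq_subr _ _) _.
  pose l0 : {ffun 'I_k -> 'I_E.+1} := [ffun i => inord (mu i - s i)].
  rewrite (bigD1 l0) //= [X in _ + X]big1 ?addr0 => [|l ll0].
    rewrite -big_split /=; congr (H _ * _).
      by apply/ffunP => i; rewrite !ffunE inordK.
    by apply: eq_bigr => i _; rewrite /F ffunE inordK // eqxx mulr1.
  have [i li] : exists i, (l i != mu i - s i :> nat)%N.
    apply/existsP; apply: contraNT ll0 => /existsPn h; apply/eqP/ffunP => i.
    by apply: val_inj; rewrite ffunE /= inordK //; have /negPn/eqP := h i.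
  by rewrite (bigD1 i) //= /F (negbTE li) !(mulr0, mul0r).
under [RHS]eq_bigr do rewrite pick.
case: ifP => [/forallP h|/negbT/forallPn[i hi]].
  rewrite /conv_inv mulr_suml; apply: eq_bigr => s _.
  rewrite mulrCA mulrA; congr (_ * _).
  by apply: eq_bigr => i _; rewrite h mulr1.
rewrite big1 // => s _.
by rewrite [X in _ * (_ * X)](bigD1 i) //= (negbTE hi) !(mulr0, mul0r).
Qed.

(** Substituting [mu = l + s] in the terms of [conv_inv] pulls out the factor
[(- c z)^|s|] and leaves a sum over the box shifted by [s]. *)
Lemma conv_inv_gf (K : comNzRingType) (c z : K) (k E : nat)
    (H : {ffun 'I_k -> nat} -> K) :
  \sum_(mu : {ffun 'I_k -> 'I_E.+1})
     conv_inv c H (fun i => mu i) * z ^+ (\sum_(i < k) mu i)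
  = \sum_(s : {ffun 'I_k -> bool}) (\prod_(i < k) (if s i then - c * z else 1))
     * \sum_(l : {ffun 'I_k -> 'I_E.+1} | [forall i, (l i + s i <= E)%N])
         H (ffun_nat l) * z ^+ (\sum_(i < k) l i).
Proof.
under eq_bigr do rewrite /conv_inv mulr_suml.
rewrite exchange_big /=; apply: eq_bigr => s _.
rewrite (bigID (fun mu : {ffun 'I_k -> 'I_E.+1} => [forall i, (s i <= mu i)%N])) /=.
rewrite [X in _ + X]big1 ?addr0 => [|mu /forallPn[i mui]]; last first.
  move: mui; rewrite -ltnNge => mus; rewrite (bigD1 i) //=.
  by case: (s i) mus; rewrite //= ltnS leqn0 => /eqP ->; rewrite mulr0 !mul0r.
pose h (l : {ffun 'I_k -> 'I_E.+1}) : {ffun 'I_k -> 'I_E.+1} :=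
  [ffun i => inord (l i + s i)].
pose h' (mu : {ffun 'I_k -> 'I_E.+1}) : {ffun 'I_k -> 'I_E.+1} :=
  [ffun i => inord (mu i - s i)].
have subE (mu : {ffun 'I_k -> 'I_E.+1}) i : (mu i - s i < E.+1)%N.
  by apply: leq_ltn_trans (leq_subr _ _) _.
(* a shift out of the box wraps to [0], which violates [s i <= mu i] *)
have inord_big m : (E < m)%N -> (inord m : 'I_E.+1) = 0%N :> nat.
  by move=> Em; rewrite /inord -[LHS]/(val _) val_insubd ltnS leqNgt Em.
rewrite (reindex_onto h h') => [|mu /forallP mus]; last first.
  by apply/ffunP => i; apply: val_inj; rewrite !ffunE /= (inordK (subE _ _)) subnK // inordK.
have noover (l : {ffun 'I_k -> 'I_E.+1}) :
    (forall i, (s i <= h l i)%N) -> forall i, (l i + s i < E.+1)%N.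
  move=> sl i; rewrite ltnNge; apply/negP => lE; move: (sl i).
  rewrite ffunE inord_big //; case: (s i) lE => //=; rewrite addn0 => lE _.
  by have := ltn_ord (l i); rewrite ltnNge lE.
rewrite mulr_sumr; apply: eq_big => [l|l /andP[/forallP sl _]].
  apply/andP/forallP => [[/forallP /noover h1 _] i|hl]; first exact: h1.
  split; first by apply/forallP => i; rewrite ffunE inordK ?leq_addl // ltnS.
  by apply/eqP/ffunP => i; rewrite !ffunE inordK ?ltnS // addnK inord_val.
have lEs := noover l sl.
have hE i : h l i = (l i + s i)%N :> nat by rewrite ffunE inordK.
have -> : [ffun i => (h l i - s i)%N] = ffun_nat l.
  by apply/ffunP => i; rewrite !ffunE inordK ?addnK.
rewrite mulrAC [RHS]mulrCA [RHS]mulrC; congr (_ * _).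
rewrite -!prodrXr -!big_split /=; apply: eq_bigr => i _.
rewrite hE; case: (s i); last by rewrite addn0.
by rewrite addn1 mulr1 exprS mulrA.
Qed.

(** * Size of the coefficients *)

Lemma big_box_geometric (R : realType) (k E : nat) (r : R) :
  \sum_(mu : {ffun 'I_k -> 'I_E.+1}) r ^+ (\sum_(i < k) mu i)
  = (\sum_(j < E.+1) r ^+ j) ^+ k.
Proof.
rewrite -[k in RHS]card_ord -prodr_const bigA_distr_bigA /=.
by apply: eq_bigr => mu _; rewrite prodrXr.
Qed.

Lemma box_geometric_le (R : realType) (k E : nat) (r : R) : 0 <= r < 1 ->
  \sum_(mu : {ffun 'I_k -> 'I_E.+1}) r ^+ (\sum_(i < k) mu i)
  <= (1 - r)^-1 ^+ k.
Proof.
move=> hr; have /andP[r0 r1] := hr; rewrite big_box_geometric.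
rewrite lerXn2r ?nnegrE ?geometric_sum_le //.
  by apply: sumr_ge0 => j _; rewrite exprn_ge0.
by rewrite invr_ge0 subr_ge0 ltW.
Qed.

Lemma conv_inv0 (K : comNzRingType) (c : K) (k : nat)
    (H : {ffun 'I_k -> nat} -> K) (mu : 'I_k -> nat) :
  (forall i, mu i = 0%N) -> conv_inv c H mu = H [ffun=> 0%N].
Proof.
move=> mu0; rewrite /conv_inv (bigD1 [ffun=> false]) //= [X in _ + X]big1 ?addr0.
  rewrite big1 ?mul1r => [|i _]; last by rewrite ffunE.
  by congr H; apply/ffunP => i; rewrite !ffunE mu0.
move=> s s0; have [i si] : exists i, s i.
  apply/existsP; apply: contraNT s0 => /existsPn h; apply/eqP/ffunP => i.
  by rewrite ffunE; apply/negbTE/h.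
by rewrite (bigD1 i) //= si mu0 mulr0 !mul0r.
Qed.

(** Apart from [s = 0], only the indicator of the single nonzero coordinate of
[mu] gives a nonzero product. *)
Lemma conv_inv1 (K : comNzRingType) (c : K) (k : nat)
    (H : {ffun 'I_k -> nat} -> K) (mu : 'I_k -> nat) :
  (\sum_(i < k) mu i)%N = 1%N ->
  conv_inv c H mu = H [ffun i => mu i] - c * H [ffun=> 0%N].
Proof.
move=> /eqP/sum_nat_eq1[i [_ mui mu0]]; have {}mu0 j : j != i -> mu j = 0%N.
  by move=> ji; apply: mu0.
rewrite /conv_inv (bigD1 [ffun=> false]) //=.
have si_neq : [ffun j => j == i] != [ffun=> false].
  by apply/eqP => /ffunP/(_ i); rewrite !ffunE eqxx.
rewrite (bigD1 [ffun j => j == i]) ?si_neq //= [X in _ + (_ + X)]big1 ?addr0.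
  rewrite big1 ?mul1r => [|j _]; last by rewrite ffunE.
  congr (_ + _); first by congr H; apply/ffunP => j; rewrite !ffunE subn0.
  rewrite -mulNr; congr (_ * _).
    rewrite (bigD1 i) //= ffunE eqxx mui mulr1 big1 ?mulr1 // => j ji.
    by rewrite ffunE (negbTE ji).
  congr H; apply/ffunP => j; rewrite !ffunE.
  by have [->|/mu0 ->] := eqVneq j i; rewrite ?mui.
move=> s /andP[s0 si]; have [j ji sj] : exists2 j, j != i & s j.
  have /existsP[j /andP[]] : [exists j, (j != i) && s j]; last by exists j.
  apply: contraT => /existsPn h.
  have sj j : j != i -> s j = false.
    by move=> ji; apply/negbTE; have := h j; rewrite ji.
  move: s0 si; case E : (s i).
    move=> _ /eqP[]; apply/ffunP => j; rewrite ffunE.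
    by have [->|/sj] := eqVneq j i.
  move=> /eqP[]; apply/ffunP => j; rewrite ffunE.
  by have [->|/sj] := eqVneq j i.
by rewrite (bigD1 j) //= sj mu0 // mulr0 !mul0r.
Qed.

(** Each of the [2^k] terms is bounded separately: a factor [p] from [s i = 1] is
compensated by the lowered exponent [mu i - 1]. *)
Lemma normc_conv_inv_le (R : realType) (p k : nat) (C : R)
    (H : {ffun 'I_k -> nat} -> R[i]) (mu : 'I_k -> nat) :
  (0 < p)%N ->
  (forall l, normc (H l) <= C * p%:R ^+ (\sum_(i < k) l i)) ->
  normc (conv_inv p%:R H mu) <= (2 ^ k)%N%:R * C * p%:R ^+ (\sum_(i < k) mu i).
Proof.
move=> p0 hH; apply: le_trans (ler_normc_sum _ _ _) _.
have p1 : 1 <= p%:R :> R by rewrite ler1n.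
have C0 : 0 <= C.
  have := le_trans (normc_ge0 _) (hH [ffun=> 0%N]).
  by rewrite pmulr_lge0 // exprn_gt0 // ltr0n.
apply: le_trans (_ : \sum_(s : {ffun 'I_k -> bool})
    C * p%:R ^+ (\sum_(i < k) mu i) <= _); last first.
  by rewrite sumr_const card_ffun card_bool card_ord -[leLHS]mulr_natl mulrA.
apply: ler_sum => s _; rewrite normcM normc_prod.
apply: le_trans (ler_wpM2l _ (hH _)) _.
  by apply: prodr_ge0 => i _; exact: normc_ge0.
rewrite mulrCA; apply: ler_wpM2l => //.
rewrite -!prodrXr -big_split /=; apply: ler_prod => i _.
rewrite mulr_ge0 ?normc_ge0 ?exprn_ge0 //= ffunE.
case: (s i); last by rewrite normc1 mul1r subn0.
rewrite normcM normcN !normc_nat; case: (mu i) => [|m] /=.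
  by rewrite mulr0 mul0r.
by rewrite mulr1 subn1 exprS.
Qed.

(** With weight [p^-(3/2 + dl)] per unit of degree, the terms of degree [1] are
of size [p^(1/2) p^-(3/2 + dl)] and those of degree [n >= 2] of size
[p^(- n (1/2 + dl))]; both are [O(p^-(1 + dl))] with a geometric decay in [n] to
spare, as [2^(-1/2) <= 3/4]. *)
Lemma conv_inv_weight_le (R : realType) (p k : nat) (C C1 dl : R)
    (H : {ffun 'I_k -> nat} -> R[i]) (mu : 'I_k -> nat) :
  (2 <= p)%N -> 0 < dl ->
  (forall l, normc (H l) <= C * p%:R ^+ (\sum_(i < k) l i)) ->
  (forall l : {ffun 'I_k -> nat}, (\sum_(i < k) l i)%N = 1%N ->
     normc (H l - p%:R * H [ffun=> 0%N]) <= C1 * Num.sqrt p%:R) ->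
  (0 < \sum_(i < k) mu i)%N ->
  normc (conv_inv p%:R H mu) * (p%:R `^ (- (2^-1 + 1 + dl))) ^+ (\sum_(i < k) mu i)
  <= (2 * `|C1| + (2 ^ k)%N%:R * 2 * C) * p%:R `^ (- (1 + dl))
     * (3 / 4) ^+ (\sum_(i < k) mu i).
Proof.
move=> p2 dl0 hH h1 mu0; set n := (\sum_(i < k) mu i)%N.
set w := p%:R `^ _; set P := p%:R `^ _.
have p0 : 0 < p%:R :> R by rewrite ltr0n (ltnW p2).
have pr2 : 2 <= p%:R :> R by rewrite ler_nat.
have p1 : 1 <= p%:R :> R by rewrite ler1n ltnW.
have P0 : 0 <= P by exact: powR_ge0.
have w0 : 0 <= w by exact: powR_ge0.
have C0 : 0 <= C.
  have := le_trans (normc_ge0 _) (hH [ffun=> 0%N]).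
  by rewrite pmulr_lge0 // exprn_gt0.
have K0 : 0 <= (2 ^ k)%N%:R * C * P by rewrite !mulr_ge0.
have pD a b : p%:R `^ (a + b) = p%:R `^ a * p%:R `^ b :> R.
  by rewrite powRD // (gt_eqF p0) implybT.
have [n1|n2] := eqVneq n 1%N.
  have hC : normc (conv_inv p%:R H mu) <= C1 * Num.sqrt p%:R.
    rewrite conv_inv1 //; apply: h1; rewrite -[RHS]n1.
    by apply: eq_bigr => i _; rewrite ffunE.
  rewrite n1 !expr1; apply: le_trans (ler_wpM2r w0 hC) _.
  have -> : C1 * Num.sqrt p%:R * w = C1 * P.
    rewrite -mulrA; congr (_ * _); rewrite -powR12_sqrt ?ler0n // -pD.
    by congr (_ `^ _); ring.
  have := ler_wpM2r P0 (ler_norm C1); have : 0 <= `|C1| * P by rewrite mulr_ge0.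
  lra.
have {}n2 : (2 <= n)%N by rewrite ltn_neqAle eq_sym n2.
have := normc_conv_inv_le mu (ltnW p2) hH; rewrite -/n => hn.
apply: le_trans (ler_wpM2r (exprn_ge0 _ w0) hn) _.
rewrite -[leLHS]mulrA -exprMn; set q := _ * w.
have qE : q = p%:R `^ (- (2^-1 + dl)).
  rewrite /q -{1}[p%:R]powRr1 ?ler0n // -pD; congr (_ `^ _); ring.
have q0 : 0 <= q by rewrite qE powR_ge0.
have qsq : q ^+ 2 <= P.
  rewrite qE -powR_mulrn ?powR_ge0 // -powRrM /P ler_powR //; lra.
(* [3/4] rather than [2^(-1/2)] as the ratio, to keep constants rational *)
have qle : q <= 3 / 4.
  apply: le_trans (_ : p%:R `^ (- 2^-1) <= _).
    by rewrite qE ler_powR //; lra.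
  rewrite powRN powR12_sqrt ?ler0n //.
  have s43 : 4 / 3 <= Num.sqrt p%:R :> R.
    rewrite -[leLHS]ger0_norm ?divr_ge0 // -sqrtr_sqr ler_sqrt ?ler0n //.
    apply: le_trans pr2; lra.
  have -> : 3 / 4 = (4 / 3)^-1 :> R by field.
  by rewrite lef_pV2 ?posrE ?sqrtr_gt0 // divr_gt0.
(* two of the [n] factors [q] give the power of [p], at a cost of [(4/3)^2 <= 2] *)
have qn : q ^+ n <= P * (2 * (3 / 4) ^+ n).
  rewrite -(subnK n2) addnC !exprD; apply: le_trans (_ : P * (3 / 4) ^+ (n - 2) <= _).
    by apply: ler_pM; rewrite ?exprn_ge0 // lerXn2r ?nnegrE ?divr_ge0.
  apply: ler_wpM2l => //; rewrite mulrA.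
  have : 0 <= (3 / 4 : R) ^+ (n - 2) by rewrite exprn_ge0 ?divr_ge0.
  move: ((3 / 4 : R) ^+ (n - 2)) => u; rewrite expr2; lra.
apply: le_trans (ler_wpM2l _ qn) _; first by rewrite mulr_ge0.
have : 0 <= `|C1| * P * (3 / 4) ^+ n.
  by rewrite !mulr_ge0 ?exprn_ge0 ?divr_ge0.
move: ((3 / 4 : R) ^+ n) ((2 ^ k)%N%:R : R) => u v; lra.
Qed.

Lemma conv_inv_box_le (R : realType) (p k E : nat) (C C1 dl : R)
    (H : {ffun 'I_k -> nat} -> R[i]) :
  (2 <= p)%N -> 0 < dl ->
  (forall l, normc (H l) <= C * p%:R ^+ (\sum_(i < k) l i)) ->
  (forall l : {ffun 'I_k -> nat}, (\sum_(i < k) l i)%N = 1%N ->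
     normc (H l - p%:R * H [ffun=> 0%N]) <= C1 * Num.sqrt p%:R) ->
  \sum_(mu : {ffun 'I_k -> 'I_E.+1} | mu != [ffun=> ord0])
    normc (conv_inv p%:R H (fun i => mu i))
      * (p%:R `^ (- (2^-1 + 1 + dl))) ^+ (\sum_(i < k) mu i)
  <= (2 * `|C1| + (2 ^ k)%N%:R * 2 * C) * 4 ^+ k * p%:R `^ (- (1 + dl)).
Proof.
move=> p2 dl0 hH h1; set A : R := 2 * `|C1| + _.
have C0 : 0 <= C.
  have := le_trans (normc_ge0 _) (hH [ffun=> 0%N]).
  by rewrite pmulr_lge0 // exprn_gt0 // ltr0n ltnW.
have A0 : 0 <= A by rewrite addr_ge0 ?mulr_ge0 // mulr_ge0.
apply: le_trans (_ : \sum_(mu : {ffun 'I_k -> 'I_E.+1})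
    A * p%:R `^ (- (1 + dl)) * (3 / 4) ^+ (\sum_(i < k) mu i) <= _).
  rewrite [leLHS]big_mkcond /=; apply: ler_sum => mu _.
  have r0 : 0 <= A * p%:R `^ (- (1 + dl)) * (3 / 4) ^+ (\sum_(i < k) mu i).
    by rewrite !mulr_ge0 ?powR_ge0 // exprn_ge0 ?divr_ge0.
  case: ifP => // /negP mu0; apply: conv_inv_weight_le => //.
  rewrite lt0n; apply/negP => /eqP s0; apply: mu0; apply/eqP/ffunP => i.
  apply: val_inj; rewrite ffunE /=; apply/eqP; rewrite -leqn0 -s0.
  by rewrite (bigD1 i) //= leq_addr.
rewrite -mulr_sumr mulrAC; apply: ler_wpM2r; first exact: powR_ge0.
apply: ler_wpM2l => //.
have r34 : 0 <= (3 / 4 : R) < 1 by apply/andP; split; lra.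
have r4 : (1 - 3 / 4 : R)^-1 = 4 by field.
by apply: le_trans (box_geometric_le k E r34) _; rewrite r4.
Qed.

(** * Sums over boxes of exponents *)

Lemma ffun_nat_inj (E k : nat) : injective (@ffun_nat E k).
Proof.
move=> u v /ffunP h; apply/ffunP => i; apply: val_inj.
by have := h i; rewrite !ffunE.
Qed.

Lemma fset_box (k : nat) (A : {fset {ffun 'I_k -> nat}}) :
  exists E0, forall E, (E0 <= E)%N -> forall l, l \in A ->
    forall i, (l i < E)%N.
Proof.
exists (\sum_(l <- A) \sum_(i < k) l i).+1%N => E EE l lA i.
apply: leq_trans EE; rewrite ltnS.
rewrite (perm_big (l :: rem l A)) ?perm_to_rem //= big_cons (bigD1 i) //=.
by rewrite -addnA leq_addr.
Qed.

Lemma sum_fset_box (V : nmodType) (k E : nat) (A : {fset {ffun 'I_k -> nat}})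
    (F : {ffun 'I_k -> nat} -> V) :
  (forall l, l \in A -> forall i, (l i < E)%N) ->
  \sum_(l <- A) F l
  = \sum_(mu : {ffun 'I_k -> 'I_E} | ffun_nat mu \in A) F (ffun_nat mu).
Proof.
move=> hA; rewrite -[RHS]big_filter.
rewrite -(big_map (@ffun_nat E k) xpredT F).
apply: perm_big; apply: uniq_perm; first exact: fset_uniq.
  rewrite map_inj_uniq; last exact: ffun_nat_inj.
  by rewrite filter_uniq // index_enum_uniq.
move=> l; apply/idP/mapP => [lA|[mu]].
  exists [ffun i => Ordinal (hA l lA i)].
    rewrite mem_filter mem_index_enum andbT.
    by have -> : ffun_nat [ffun i => Ordinal (hA l lA i)] = l
      by apply/ffunP => i; rewrite !ffunE.
  by apply/ffunP => i; rewrite !ffunE.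
by rewrite mem_filter => /andP[muA _] ->.
Qed.

Lemma fset_of_box (V : nmodType) (k E : nat) (P : pred {ffun 'I_k -> 'I_E}) :
  exists2 B : {fset {ffun 'I_k -> nat}},
    forall mu, (ffun_nat mu \in B) = P mu
    & forall F : {ffun 'I_k -> nat} -> V,
      \sum_(l <- B) F l = \sum_(mu | P mu) F (ffun_nat mu).
Proof.
pose s := [seq ffun_nat mu | mu <- index_enum {ffun 'I_k -> 'I_E} & P mu].
have sP mu : (ffun_nat mu \in s) = P mu.
  by rewrite mem_map ?mem_filter ?mem_index_enum ?andbT //; exact: ffun_nat_inj.
have us : uniq s.
  rewrite map_inj_uniq ?filter_uniq ?index_enum_uniq //; exact: ffun_nat_inj.
exists [fset l in s]%fset => [mu|F]; first by rewrite inE sP.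
rewrite (perm_big s) /=; first by rewrite big_map big_filter.
by apply: uniq_perm; rewrite ?fset_uniq // => l; rewrite inE.
Qed.

(** Uniformity in [s] is what [conv_inv_gf] requires; it holds because every box
shifted by some [s] contains the common box of side [E]. *)
Lemma box_sum_near (R : realType) (k : nat) (phi : {ffun 'I_k -> nat} -> R[i]^o)
    (S : R[i]^o) (e : R) :
  partial_sum phi @ totally --> S -> 0 < e ->
  exists E0, forall E, (E0 <= E)%N -> forall s : {ffun 'I_k -> bool},
    normc (S - \sum_(l : {ffun 'I_k -> 'I_E.+1} | [forall i, (l i + s i <= E)%N])
      phi (ffun_nat l)) < e.
Proof.
move=> hS e0; have tF := @totally_filter {ffun 'I_k -> nat}.
have /cvg_normcP/(_ e e0) [A _ hA] := hS.
have [E0 hE0] := fset_box A; exists E0 => E EE s.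
have [B BP BS] := fset_of_box (R[i]^o : nmodType)
  (fun l : {ffun 'I_k -> 'I_E.+1} => [forall i, (l i + s i <= E)%N]).
have := hA B; rewrite /partial_sum /= -(big_seq_fsetE _ _ xpredT phi) /= BS.
apply; apply/fsubsetP => l lA.
have lE i : (l i < E)%N by exact: hE0 lA i.
have -> : l = ffun_nat [ffun i => inord (l i) : 'I_E.+1].
  by apply/ffunP => i; rewrite !ffunE inordK // ltnS ltnW.
rewrite BP; apply/forallP => i; rewrite ffunE inordK ?ltnS ?(ltnW (lE i)) //.
by case: (s i); rewrite ?addn1 ?addn0 ?lE // ltnW.
Qed.

(** Each truncation in [conv_inv_gf] exhausts all tuples, so the full inner sum
factors out of [\sum_s (- c z)^|s| = (1 - c z)^k]. *)
Lemma conv_inv_box_cvg (R : realType) (k : nat) (c z S : R[i])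
    (H : {ffun 'I_k -> nat} -> R[i]) :
  partial_sum (fun l => H l * z ^+ (\sum_(i < k) l i) : R[i]^o) @ totally
    --> (S : R[i]^o) ->
  (fun E : nat => \sum_(mu : {ffun 'I_k -> 'I_E.+1})
     conv_inv c H (fun i => mu i) * z ^+ (\sum_(i < k) mu i) : R[i]^o) @ \oo
    --> ((1 - c * z) ^+ k * S : R[i]^o).
Proof.
move=> hS; apply/cvg_normcP => e e0.
pose a (s : {ffun 'I_k -> bool}) := \prod_(i < k) (if s i then - c * z else 1).
pose M := \sum_s normc (a s) + 1.
have M0 : 0 < M by rewrite ltr_wpDl // sumr_ge0 // => s _; exact: normc_ge0.
have [E0 hE0] := box_sum_near hS (divr_gt0 e0 M0).
exists E0 => // E /= EE; rewrite conv_inv_gf.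
have -> : (1 - c * z) ^+ k = \sum_s a s.
  rewrite -[k in LHS]card_ord -prodr_const /a.
  rewrite -(bigA_distr_bigA (fun _ b => if b then - c * z else 1)).
  by apply: eq_bigr => i _; rewrite big_bool /= mulNr addrC.
rewrite mulr_suml -sumrB; apply: le_lt_trans (ler_normc_sum _ _ _) _.
apply: le_lt_trans (_ : \sum_s normc (a s) * (e / M) < _).
  apply: ler_sum => s _; rewrite -mulrBr normcM.
  apply: ler_wpM2l; first exact: normc_ge0.
  apply: le_trans (ltW (hE0 _ EE s)); rewrite le_eqVlt; apply/orP; left.
  apply/eqP; congr (normc (_ - _)); apply: eq_bigr => l _.
  by congr (_ * _ ^+ _); apply: eq_bigr => i _; rewrite ffunE.
rewrite -mulr_suml mulrA ltr_pdivrMr // mulrC ltr_pM2l //.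
by rewrite /M ltrDl.
Qed.

(** * Local factors *)

Definition maxpow (R : realType) (f : nat -> R[i]) (k p : nat)
    (l : {ffun 'I_k -> nat}) : R[i] := f (p ^ (\max_(i < k) l i))%N.

Lemma bigmax_le_sum (k : nat) (l : 'I_k -> nat) :
  (\max_(i < k) l i <= \sum_(i < k) l i)%N.
Proof. by apply/bigmax_leqP => i _; rewrite (bigD1 i) //= leq_addr. Qed.

Lemma maxpow0 (R : realType) (f : nat -> R[i]) (k p : nat) :
  f 1%N = 1 -> maxpow f p [ffun _ : 'I_k => 0%N] = 1.
Proof. by move=> f1; rewrite /maxpow big1 // => i _; rewrite ffunE. Qed.

(** Exponents [0], [1] and at least [2] are controlled by [f 1 = 1], by the
estimate at primes and by the estimate at prime powers; replacing the maximum of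
the exponents by their sum makes the bound multiplicative in the coordinates. *)
Lemma class_A1_maxpow (R : realType) (f : nat -> R[i]) : class_A1 f ->
  exists C C1 : R, forall k p : nat, prime p ->
    (forall l : {ffun 'I_k -> nat},
       normc (maxpow f p l) <= C * p%:R ^+ (\sum_(i < k) l i)) /\
    (forall l : {ffun 'I_k -> nat}, (\sum_(i < k) l i)%N = 1%N ->
       normc (maxpow f p l - p%:R * maxpow f p [ffun _ : 'I_k => 0%N])
       <= C1 * Num.sqrt p%:R).
Proof.
move=> [[f1 _] [C1 [C2 [h1 h2]]]].
have {}h1 p : prime p -> normc (f p - p%:R) <= C1 * Num.sqrt p%:R.
  by move=> pp; have := h1 p pp; rewrite normC_normc lecR.
have {}h2 p nu : prime p -> (2 <= nu)%N -> normc (f (p ^ nu)%N) <= C2 * (p ^ nu)%:R.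
  by move=> pp nu2; have := h2 p nu pp nu2; rewrite normC_normc lecR.
exists (1 + `|C1| + `|C2|), C1 => k p pp.
have p0 : 0 < p%:R :> R by rewrite ltr0n prime_gt0.
have p1 : 1 <= p%:R :> R by rewrite ler1n prime_gt0.
have C0 : 0 <= 1 + `|C1| + `|C2| by rewrite !addr_ge0.
split=> [l|l l1]; last first.
  have -> : maxpow f p l = f p.
    rewrite /maxpow; suff -> : (\max_(i < k) l i)%N = 1%N by rewrite expn1.
    apply/eqP; rewrite eqn_leq -{1}l1 bigmax_le_sum /= lt0n.
    apply/negP => /eqP l0; move: l1; rewrite big1 // => i _.
    by apply/eqP; rewrite -leqn0 -l0; exact: (leq_bigmax i).
  by rewrite maxpow0 // mulr1; exact: h1.
apply: le_trans (_ : (1 + `|C1| + `|C2|) * p%:R ^+ (\max_(i < k) l i) <= _); last first.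
  by apply: ler_wpM2l => //; rewrite ler_eXn2l ?ltr1n ?prime_gt1 // bigmax_le_sum.
rewrite /maxpow; case: (\max_(i < k) l i)%N => [|[|n]].
- by rewrite expn0 f1 normc1 expr0 mulr1 -addrA lerDl addr_ge0.
- rewrite expn1 expr1 -[f p](subrK p%:R); apply: le_trans (le_normcD _ _) _.
  rewrite normc_nat; apply: le_trans (lerD (h1 p pp) (lexx _)) _.
  have s1 : Num.sqrt p%:R <= p%:R :> R.
    rewrite -[leRHS]ger0_norm ?ler0n // -sqrtr_sqr ler_wsqrtr // expr2 ler_peMl //.
  have : C1 * Num.sqrt p%:R <= `|C1| * p%:R.
    apply: le_trans (_ : `|C1| * Num.sqrt p%:R <= _).
      by apply: ler_wpM2r; rewrite ?sqrtr_ge0 ?ler_norm.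
    by apply: ler_wpM2l.
  have : 0 <= `|C2| * p%:R by rewrite mulr_ge0.
  lra.
apply: le_trans (h2 p n.+2 pp isT) _; rewrite natrX; apply: ler_wpM2r.
  by rewrite exprn_ge0.
have := ler_norm C2; have := normr_ge0 C1; lra.
Qed.

Lemma local_termE (R : realType) (f : nat -> R[i]) (k p : nat) :
  @local_term R f k p
  = (fun l => maxpow f p l * ((p%:R ^+ 2)^-1) ^+ (\sum_(i < k) l i) : R[i]^o).
Proof. by apply/funext => l; rewrite /local_term exprM exprVn. Qed.

Lemma local_series_cvg_bound (R : realType) (f : nat -> R[i]) (k p : nat) (C : R) :
  (2 <= p)%N ->
  (forall l : {ffun 'I_k -> nat},
     normc (maxpow f p l) <= C * p%:R ^+ (\sum_(i < k) l i)) ->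
  local_series_cvg f k p.
Proof.
move=> p2 hC.
have p0 : 0 < p%:R :> R by rewrite ltr0n ltnW.
have C0 : 0 <= C.
  have := le_trans (normc_ge0 _) (hC [ffun=> 0%N]).
  by rewrite pmulr_lge0 // exprn_gt0.
have term_le (l : {ffun 'I_k -> nat}) :
    normc (local_term f p l) <= C * 2^-1 ^+ (\sum_(i < k) l i).
  rewrite local_termE normcM normcX normcV normcX normc_nat.
  apply: le_trans (ler_wpM2r _ (hC l)) _; first by rewrite exprn_ge0 // invr_ge0 exprn_ge0.
  rewrite -mulrA -exprMn; apply: ler_wpM2l => //.
  have -> : p%:R * (p%:R ^+ 2)^-1 = p%:R^-1 :> R by field; rewrite gt_eqF.
  rewrite lerXn2r ?nnegrE ?invr_ge0 ?(ltW p0) //.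
  by rewrite lef_pV2 ?posrE // ler_nat.
apply: (@cvg_partial_sum_abs _ _ _ (C * (1 - 2^-1)^-1 ^+ k)) => A.
have [E0 /(_ E0.+1 (leqnSn _)) hE] := fset_box A.
rewrite (sum_fset_box _ hE).
apply: le_trans (_ : \sum_(mu : {ffun 'I_k -> 'I_E0.+1})
    C * 2^-1 ^+ (\sum_(i < k) mu i) <= _); last first.
  rewrite -mulr_sumr; apply: ler_wpM2l => //; apply: box_geometric_le.
  by apply/andP; split; lra.
rewrite [leLHS]big_mkcond /=; apply: ler_sum => mu _.
have e0 : 0 <= C * 2^-1 ^+ (\sum_(i < k) mu i) by rewrite mulr_ge0 // exprn_ge0.
case: ifP => // _; apply: le_trans (term_le _) _.
by rewrite le_eqVlt; apply/orP; left; apply/eqP; congr (_ * _ ^+ _);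
  apply: eq_bigr => i _; rewrite ffunE.
Qed.

(** As [p * p^-2 = p^-1], the factor [(1 - c z)^k] of [conv_inv_box_cvg] is the
convergence factor [(1 - p^-1)^k] of the Euler product. *)
Lemma local_factor_cvg (R : realType) (f : nat -> R[i]) (k p : nat) :
  prime p -> local_series_cvg f k p ->
  (fun E : nat => \sum_(mu : {ffun 'I_k -> 'I_E.+1})
     conv_inv p%:R (@maxpow R f k p) (fun i => mu i)
       * ((p%:R ^+ 2)^-1) ^+ (\sum_(i < k) mu i) : R[i]^o) @ \oo
  --> (local_factor f k p : R[i]^o).
Proof.
move=> pp hc; rewrite /local_factor.
have p0 : p%:R != 0 :> R[i] by rewrite pnatr_eq0 -lt0n prime_gt0.
have -> : p%:R^-1 = p%:R * (p%:R ^+ 2)^-1 :> R[i] by rewrite expr2 invfM mulVKf.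
by apply: conv_inv_box_cvg; rewrite -local_termE.
Qed.

Lemma conv_inv_maxpow0 (R : realType) (f : nat -> R[i]) (k E p : nat) :
  f 1%N = 1 ->
  conv_inv p%:R (@maxpow R f k p) (fun i => ([ffun=> ord0] : {ffun 'I_k -> 'I_E.+1}) i)
  = 1.
Proof. by move=> f1; rewrite conv_inv0 ?maxpow0 // => i; rewrite ffunE. Qed.

(** Both the truncated absolute local sums and the local factors of the Euler
product are [1 + O(p^-(1 + dl))], uniformly in [p]. *)
Lemma local_bounds (R : realType) (f : nat -> R[i]) (k : nat) (dl : R) :
  class_A1 f -> 0 < dl <= 2^-1 ->
  exists2 K : R, 0 <= K & forall p : nat, prime p ->
    (forall E : nat, \sum_(mu : {ffun 'I_k -> 'I_E.+1})
       normc (conv_inv p%:R (@maxpow R f k p) (fun i => mu i))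
         * (p%:R `^ (- (2^-1 + 1 + dl))) ^+ (\sum_(i < k) mu i)
       <= 1 + K * p%:R `^ (- (1 + dl))) /\
    normc (local_factor f k p - 1) <= K * p%:R `^ (- (1 + dl)).
Proof.
move=> hf /andP[dl0 dl1]; have [[f1 _] _] := hf.
have [C [C1 hC]] := class_A1_maxpow hf.
pose K := (2 * `|C1| + (2 ^ k)%N%:R * 2 * C) * 4 ^+ k.
have C0 : 0 <= C.
  have [h _] := hC 0%N 2%N isT; have := le_trans (normc_ge0 _) (h [ffun=> 0%N]).
  by rewrite big_ord0 expr0 mulr1.
exists K; first by rewrite mulr_ge0 ?exprn_ge0 // addr_ge0 ?mulr_ge0 // mulr_ge0.
move=> p pp; have [h1 h2] := hC k p pp; have p2 := prime_gt1 pp.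
have p0 : 0 < p%:R :> R by rewrite ltr0n ltnW.
have p1 : 1 <= p%:R :> R by rewrite ler1n ltnW.
have box E := @conv_inv_box_le R p k E C C1 dl _ p2 dl0 h1 h2.
have sum0 E : (\sum_(i < k) ([ffun=> ord0] : {ffun 'I_k -> 'I_E.+1}) i)%N = 0%N.
  by rewrite big1 // => i _; rewrite ffunE.
split=> [E|].
  rewrite (bigD1 [ffun=> ord0]) //= conv_inv_maxpow0 // normc1 sum0 expr0 mul1r.
  by rewrite lerD2l; exact: box.
have hc := local_series_cvg_bound p2 h1.
rewrite normcB -[local_factor f k p]mul1r.
apply: (normc_cvg_le (local_factor_cvg pp hc)).
exists 0%N => // E _; rewrite mul1r.
rewrite (bigD1 [ffun=> ord0]) //= conv_inv_maxpow0 // sum0 expr0 mul1r.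
rewrite opprD addNKr normcN; apply: le_trans (ler_normc_sum _ _ _) _.
apply: le_trans (box E); apply: ler_sum => mu _.
rewrite normcM; apply: ler_wpM2l; first exact: normc_ge0.
rewrite normcX normcV normcX normc_nat.
rewrite lerXn2r ?nnegrE ?powR_ge0 ?invr_ge0 ?exprn_ge0 //.
rewrite -powR_mulrn ?ler0n // -powRN ler_powR //; lra.
Qed.

(** * Expansion of the summand over divisors *)

Lemma multiplicative_prod (R : realType) (f : nat -> R[i]) (N : nat) (e : nat -> nat) :
  multiplicative_fun f ->
  f (\prod_(0 <= p < N | prime p) p ^ e p)%N
  = \prod_(0 <= p < N | prime p) f (p ^ e p)%N.
Proof.
move=> [f1 fM]; rewrite big_mkcond [RHS]big_mkcond /=.
elim: N => [|N IH]; first by rewrite !big_geq.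
rewrite !big_nat_recr //= -IH; case: ifP => pN; last by rewrite muln1 mulr1.
apply: fM.
- by apply: prodn_gt0 => p; case: ifP => // /prime_gt0 p0; rewrite expn_gt0 p0.
- by rewrite expn_gt0 prime_gt0.
rewrite big_seq; apply: (big_ind (fun n => coprime n (N ^ e N))).
- by rewrite coprime1n.
- by move=> a b ha hb; rewrite coprimeMl ha.
move=> p; rewrite mem_index_iota => /andP[_ pltN]; case: ifP => pp; last exact: coprime1n.
apply: coprimeXl; apply: coprimeXr; rewrite prime_coprime // dvdn_prime2 //.
by rewrite neq_ltn pltN.
Qed.

Lemma prod_logn (N n : nat) :
  (0 < n)%N -> (forall p, prime p -> (p %| n)%N -> (p < N)%N) ->
  n = (\prod_(0 <= p < N | prime p) p ^ logn p n)%N.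
Proof.
move=> n0 hn; set m := maxn N n.
have nm : (n <= m)%N by rewrite leq_maxr.
have log0 p : ~~ (prime p && (p %| n)%N) -> (p ^ logn p n = 1)%N.
  by move=> h; rewrite [logn _ _](_ : _ = 0%N) //; apply/eqP;
    rewrite -leqn0 leqNgt logn_gt0 mem_primes n0.
rewrite -[LHS](partnT n0) (widen_partn _ nm) (@big_cat_nat _ _ _ N) //=; last first.
  by rewrite ltnW // ltnS leq_maxl.
rewrite [X in (_ * X)%N]big1_seq ?muln1 => [|p /andP[_]]; last first.
  rewrite mem_index_iota => /andP[Np _]; apply: log0; apply/negP => /andP[pp pn].
  by have := hn p pp pn; rewrite ltnNge Np.
rewrite [RHS]big_mkcond /=; apply: eq_bigr => p _; case: ifP => // pp.
by rewrite log0 // pp.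
Qed.

Lemma lcm_tuple_gt0 (k : nat) (n : {ffun 'I_k -> nat}) :
  (forall i, (0 < n i)%N) -> (0 < lcm_tuple n)%N.
Proof.
by move=> n0; rewrite /lcm_tuple; elim/big_ind: _ => // a b a0 b0; rewrite lcmn_gt0 a0.
Qed.

Lemma logn_lcm_tuple (k p : nat) (n : {ffun 'I_k -> nat}) :
  (forall i, (0 < n i)%N) -> logn p (lcm_tuple n) = (\max_(i < k) logn p (n i))%N.
Proof.
move=> n0; rewrite /lcm_tuple.
pose K m e := (0 < m)%N /\ logn p m = e.
suff [] : K (\big[lcmn/1%N]_(i < k) n i) (\max_(i < k) logn p (n i))%N by [].
apply: (big_rec2 K) => [|i m e _ [m0 me]]; rewrite /K ?logn1 //.
by rewrite lcmn_gt0 n0 m0 logn_lcm ?n0 // me.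
Qed.

(** A type rather than a predicate, so that a product over the primes of sums over
exponents expands into a sum over functions. *)
Definition prime_below (N : nat) := {p : 'I_N | p \in [pred p : 'I_N | prime p]}.

Definition pval (N : nat) (q : prime_below N) : nat := val (val q).

Lemma pval_prime (N : nat) (q : prime_below N) : prime (pval q).
Proof. exact: (valP q). Qed.

Lemma big_prime_below (T : Type) (idx : T) (op : Monoid.com_law idx) (N : nat)
    (F : nat -> T) :
  \big[op/idx]_(0 <= p < N | prime p) F p
  = \big[op/idx]_(q : prime_below N) F (pval q).
Proof.
by rewrite big_mkord -(big_sub [pred p : 'I_N | prime p] (fun p => F (val p))).
Qed.

(** Tuples of integers are encoded by their exponents, [D] running over all tuples
with prime factors below [N] and exponents below [E]. *)
Definition exp_tuple (N E k : nat) (D : {ffun prime_below N -> {ffun 'I_k -> 'I_E}})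
    (i : 'I_k) : nat := (\prod_(q : prime_below N) pval q ^ D q i)%N.

Lemma exp_tuple_gt0 (N E k : nat) (D : {ffun prime_below N -> {ffun 'I_k -> 'I_E}}) i :
  (0 < exp_tuple D i)%N.
Proof. by apply: prodn_gt0 => q; rewrite expn_gt0 prime_gt0 ?pval_prime. Qed.

Lemma exp_tuple_dvd (N E k n : nat)
    (D : {ffun prime_below N -> {ffun 'I_k -> 'I_E}}) i :
  (0 < n)%N -> (forall p, prime p -> (p %| n)%N -> (p < N)%N) ->
  (exp_tuple D i %| n)%N = [forall q, (D q i <= logn (pval q) n)%N] /\
  ([forall q, (D q i <= logn (pval q) n)%N] ->
   (n %/ exp_tuple D i)%N
   = \prod_(q : prime_below N) pval q ^ (logn (pval q) n - D q i))%N.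
Proof.
move=> n0 hn.
have nE : [forall q, (D q i <= logn (pval q) n)%N] ->
  n = ((\prod_(q : prime_below N) pval q ^ (logn (pval q) n - D q i))
       * exp_tuple D i)%N.
  move=> /forallP h; rewrite [LHS](prod_logn n0 hn) big_prime_below.
  rewrite /exp_tuple -big_split /=; apply: eq_bigr => q _.
  by rewrite -expnD subnK.
split=> [|h]; last by rewrite {1}(nE h) mulnK // exp_tuple_gt0.
apply/idP/idP => [h|h]; last by rewrite {1}(nE h) dvdn_mull.
apply/forallP => q; rewrite -pfactor_dvdn ?pval_prime //.
by apply: dvdn_trans h; rewrite /exp_tuple (bigD1 q) //= dvdn_mulr.
Qed.

(** Expanding [f (lcm n) = \prod_p f (p^(max_i v_p(n_i)))] with [conv_invK] at
each prime writes [f (lcm n)] as a sum over the tuples of divisors [d_i | n_i]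
of a multiplicative coefficient times [\prod_i n_i / d_i]. *)
Lemma lcm_tuple_expansion (R : realType) (f : nat -> R[i]) (k N E : nat)
    (n : {ffun 'I_k -> nat}) :
  multiplicative_fun f -> (forall i, (0 < n i)%N) ->
  (forall i, (n i < N)%N) -> (forall i, (n i <= E)%N) ->
  f (lcm_tuple n)
  = \sum_(D : {ffun prime_below N -> {ffun 'I_k -> 'I_E.+1}} |
          [forall i, (exp_tuple D i %| n i)%N])
      (\prod_(q : prime_below N)
         conv_inv (pval q)%:R (maxpow f (pval q)) (fun i => D q i))
      * \prod_(i < k) (n i %/ exp_tuple D i)%N%:R.
Proof.
move=> fM n0 nN nE.
have small i p : prime p -> (p %| n i)%N -> (p < N)%N.
  by move=> _ /(dvdn_leq (n0 i)) pn; apply: leq_ltn_trans (nN i).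
have hlcm p : prime p -> (p %| lcm_tuple n)%N -> (p < N)%N.
  move=> pp pl; have : (0 < logn p (lcm_tuple n))%N.
    by rewrite logn_gt0 mem_primes pp lcm_tuple_gt0.
  rewrite logn_lcm_tuple // => h; have [i ni] : exists i, (0 < logn p (n i))%N.
    apply/existsP; apply: contraTT h => /existsPn h.
    by rewrite -leqNgt; apply/bigmax_leqP => i _; rewrite leqNgt.
  by move: ni; rewrite logn_gt0 mem_primes => /and3P[_ _ /(small _ _ pp)].
rewrite [X in f X](prod_logn (lcm_tuple_gt0 n0) hlcm).
rewrite (multiplicative_prod N (fun p => logn p (lcm_tuple n)) fM).
rewrite (big_prime_below _ N (fun p => f (p ^ logn p (lcm_tuple n))%N)) /=.
pose nu (q : prime_below N) : {ffun 'I_k -> nat} := [ffun i => logn (pval q) (n i)].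
have local (q : prime_below N) : f (pval q ^ logn (pval q) (lcm_tuple n))%N
    = \sum_(mu : {ffun 'I_k -> 'I_E.+1})
        (if [forall i, (mu i <= nu q i)%N] then
         conv_inv (pval q)%:R (maxpow f (pval q)) (fun i => mu i)
         * \prod_(i < k) (pval q)%:R ^+ (nu q i - mu i) else 0).
  rewrite -big_mkcond conv_invK => [|i].
    rewrite /maxpow logn_lcm_tuple //; congr (f (_ ^ _)%N).
    by apply: eq_bigr => i _; rewrite ffunE.
  rewrite ffunE; apply: leq_trans (nE i); apply: ltnW.
  by rewrite ltn_logl ?n0.
under eq_bigr do rewrite local.
rewrite bigA_distr_bigA /= [RHS]big_mkcond /=; apply: eq_bigr => D _.
have dvdE : [forall i, (exp_tuple D i %| n i)%N]
    = [forall q, [forall i, (D q i <= nu q i)%N]].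
  apply/forallP/forallP => [h q|h i].
    apply/forallP => i; rewrite ffunE.
    by have := h i; rewrite (exp_tuple_dvd D i (n0 i) (small i)).1 => /forallP.
  rewrite (exp_tuple_dvd D i (n0 i) (small i)).1; apply/forallP => q.
  by have /forallP/(_ i) := h q; rewrite ffunE.
rewrite dvdE; case: ifP => [/forallP h|/negbT/forallPn[q /negbTE hq]]; last first.
  by rewrite (bigD1 q) //= hq mul0r.
under eq_bigr do rewrite h.
rewrite big_split /=; congr (_ * _); rewrite exchange_big /=.
apply: eq_bigr => i _.
rewrite (exp_tuple_dvd D i (n0 i) (small i)).2; last first.
  by apply/forallP => q; have /forallP/(_ i) := h q; rewrite ffunE.
by rewrite natr_prod; apply: eq_bigr => q _; rewrite natrX ffunE.
Qed.

(** * The sum over lattice points *)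

Lemma lcm_sum_finite (R : realType) (f : nat -> R[i]) (k M : nat) (x : R) :
  (forall m : nat, (m ^ 2)%:R <= x -> (m < M)%N) ->
  lcm_sum f k x
  = \sum_(n : {ffun 'I_k -> 'I_M} |
        [forall i, (0 < n i)%N] && ((\sum_(i < k) n i ^ 2)%N%:R <= x))
      f (lcm_tuple (ffun_nat n)).
Proof.
move=> hM; rewrite /lcm_sum; set D := [set n | _].
have DE (n : {ffun 'I_k -> 'I_M}) : D (ffun_nat n)
    <-> [forall i, (0 < n i)%N] && ((\sum_(i < k) n i ^ 2)%N%:R <= x).
  have sE : (\sum_(i < k) ffun_nat n i ^ 2 = \sum_(i < k) n i ^ 2)%N.
    by apply: eq_bigr => i _; rewrite ffunE.
  rewrite /D /= sE; split=> [[h ->]|/andP[/forallP h ->]].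
    by rewrite andbT; apply/forallP => i; have := h i; rewrite ffunE.
  by split=> // i; rewrite ffunE.
have bounded (n : {ffun 'I_k -> nat}) : D n -> forall i, (n i < M)%N.
  move=> [_ nx] i; apply: hM; apply: le_trans nx.
  by rewrite ler_nat (bigD1 i) //= leq_addr.
have finD : finite_set D.
  have [B BP _] := fset_of_box (R[i] : nmodType) (@predT {ffun 'I_k -> 'I_M}).
  apply: sub_finite_set (finite_fset B) => n Dn /=.
  have -> : n = ffun_nat [ffun i => Ordinal (bounded n Dn i)].
    by apply/ffunP => i; rewrite !ffunE.
  by rewrite BP.
rewrite fsbig_finite // (@sum_fset_box _ _ M) => [|l].
  apply: eq_bigl => n; rewrite in_fset_set //.
  by apply/idP/idP => [/set_mem /DE|/DE /mem_set].
by rewrite in_fset_set // => /set_mem; exact: bounded.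
Qed.

Lemma powR_prod (R : realType) (I : Type) (r : seq I) (P : pred I) (F : I -> nat)
    (a : R) :
  (\prod_(i <- r | P i) F i)%N%:R `^ a = \prod_(i <- r | P i) (F i)%:R `^ a :> R.
Proof.
elim/big_rec2: _ => [|i y m _ <-]; first by rewrite powR1.
by rewrite natrM powRM.
Qed.

Lemma exp_tuple_prod (N E k : nat)
    (D : {ffun prime_below N -> {ffun 'I_k -> 'I_E}}) :
  (\prod_(i < k) exp_tuple D i
   = \prod_(q : prime_below N) pval q ^ (\sum_(i < k) D q i))%N.
Proof.
rewrite exchange_big /=; apply: eq_bigr => q _.
by rewrite expn_sum.
Qed.

(** Insert [lcm_tuple_expansion], sum over [n] first and replace each inner sum
by its main term; the coefficients then factor over the primes again. *)
Lemma lcm_sum_truncated (R : realType) (f : nat -> R[i]) (k M N E : nat)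
    (x theta : R) :
  multiplicative_fun f -> (0 < k)%N -> 0 < x -> 0 <= theta <= 1 ->
  (forall m : nat, (m ^ 2)%:R <= x -> (m < M)%N) -> (M <= N)%N -> (M <= E)%N ->
  normc (lcm_sum f k x
    - (x ^+ k / (2 ^ k * k`!)%N%:R)%:C
      * \prod_(q : prime_below N) \sum_(mu : {ffun 'I_k -> 'I_E.+1})
          conv_inv (pval q)%:R (maxpow f (pval q)) (fun i => mu i)
          * (((pval q)%:R ^+ 2)^-1) ^+ (\sum_(i < k) mu i))
  <= (2 * k)%N%:R * x `^ (k%:R - theta / 2)
     * \prod_(q : prime_below N) \sum_(mu : {ffun 'I_k -> 'I_E.+1})
         normc (conv_inv (pval q)%:R (maxpow f (pval q)) (fun i => mu i))
         * ((pval q)%:R `^ (theta - 2)) ^+ (\sum_(i < k) mu i).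
Proof.
move=> fM k0 x0 ht hM MN ME.
pose G (D : {ffun prime_below N -> {ffun 'I_k -> 'I_E.+1}}) : R[i] :=
  \prod_(q : prime_below N)
    conv_inv (pval q)%:R (maxpow f (pval q)) (fun i => D q i).
pose Q (D : {ffun prime_below N -> {ffun 'I_k -> 'I_E.+1}}) : nat :=
  (\prod_(i < k) exp_tuple D i)%N.
have -> : lcm_sum f k x = \sum_D G D * (lattice_sum M (exp_tuple D) x)%:C.
  rewrite (lcm_sum_finite f k hM).
  transitivity (\sum_(n : {ffun 'I_k -> 'I_M} |
      [forall i, (0 < n i)%N] && ((\sum_(i < k) n i ^ 2)%N%:R <= x))
    \sum_(D : {ffun prime_below N -> {ffun 'I_k -> 'I_E.+1}} |
      [forall i, (exp_tuple D i %| n i)%N])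
      G D * \prod_(i < k) (n i %/ exp_tuple D i)%N%:R).
    apply: eq_bigr => n /andP[/forallP n0 _].
    have nM i : (n i < M)%N by [].
    rewrite (@lcm_tuple_expansion _ f k N E) //.
    - apply: eq_big => D; first by apply: eq_forallb => i; rewrite ffunE.
      by move=> _; congr (_ * _); apply: eq_bigr => i _; rewrite ffunE.
    - by move=> i; rewrite ffunE.
    - by move=> i; rewrite ffunE; exact: leq_trans MN.
    - by move=> i; rewrite ffunE ltnW //; exact: leq_trans ME.
  rewrite (exchange_big_dep xpredT) //=; apply: eq_bigr => D _.
  rewrite /lattice_sum rmorph_sum mulr_sumr /=; apply: eq_big => n.
    rewrite andbC andbA; congr (_ && _).
    apply/andP/forallP => [[/forallP h1 /forallP h2] i|h].
      by rewrite h1 h2.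
    by split; apply/forallP => i; have /andP[] := h i.
  move=> _; congr (_ * _); rewrite rmorph_prod /=.
  by apply: eq_bigr => i _; rewrite real_complex_nat.
have -> : \prod_(q : prime_below N) \sum_(mu : {ffun 'I_k -> 'I_E.+1})
      conv_inv (pval q)%:R (maxpow f (pval q)) (fun i => mu i)
      * (((pval q)%:R ^+ 2)^-1) ^+ (\sum_(i < k) mu i)
    = \sum_D G D * ((Q D)%:R ^+ 2)^-1.
  rewrite bigA_distr_bigA; apply: eq_bigr => D _.
  rewrite big_split /=; congr (_ * _).
  rewrite /Q exp_tuple_prod natr_prod -prodrXl -prodfV; apply: eq_bigr => q _.
  by rewrite natrX exprVn -!exprM mulnC.
have -> : \prod_(q : prime_below N) \sum_(mu : {ffun 'I_k -> 'I_E.+1})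
      normc (conv_inv (pval q)%:R (maxpow f (pval q)) (fun i => mu i))
      * ((pval q)%:R `^ (theta - 2)) ^+ (\sum_(i < k) mu i)
    = \sum_D normc (G D) * (Q D)%:R `^ (theta - 2).
  rewrite bigA_distr_bigA; apply: eq_bigr => D _.
  rewrite big_split /= -normc_prod; congr (_ * _).
  rewrite /Q exp_tuple_prod powR_prod; apply: eq_bigr => q _.
  by rewrite natrX -[in LHS]powR_mulrn // -powRrM mulrC powRrM powR_mulrn ?powR_ge0.
rewrite !mulr_sumr -sumrB; apply: le_trans (ler_normc_sum _ _ _) _.
apply: ler_sum => D _.
have Q0 : (Q D)%:R != 0 :> R.
  by rewrite pnatr_eq0 -lt0n; apply: prodn_gt0 => i; exact: exp_tuple_gt0.
have -> : G D * (lattice_sum M (exp_tuple D) x)%:C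
     - (x ^+ k / (2 ^ k * k`!)%N%:R)%:C * (G D * ((Q D)%:R ^+ 2)^-1)
   = G D * (lattice_sum M (exp_tuple D) x
            - x ^+ k / ((2 ^ k * k`!)%N%:R * (Q D)%:R ^+ 2))%:C.
  rewrite rmorphB /= mulrBr; congr (_ - _); rewrite mulrCA; congr (_ * _).
  rewrite -real_complex_nat -rmorphXn -fmorphV -rmorphM /=.
  by congr (_%:C); rewrite [in RHS]invfM mulrA.
rewrite normcM normc_real [leRHS]mulrCA; apply: ler_wpM2l; first exact: normc_ge0.
rewrite -[leRHS]mulrA; apply: lattice_sum_interp => // i; exact: exp_tuple_gt0.
Qed.

Lemma cvg_prod_normc (R : realType) (I : Type) (r : seq I)
    (F : I -> nat -> R[i]^o) (l : I -> R[i]^o) :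
  (forall i, F i @ \oo --> l i) ->
  (fun n : nat => \prod_(i <- r) F i n : R[i]^o) @ \oo
    --> (\prod_(i <- r) l i : R[i]^o).
Proof.
move=> h; elim: r => [|i r IH].
  rewrite big_nil; under eq_fun do rewrite big_nil; exact: cvg_cst.
rewrite big_cons; under eq_fun do rewrite big_cons.
exact: (@cvgM _ _ _ _ (F i) _ (l i) _ (h i) IH).
Qed.

(** * The asymptotic formula *)

Lemma euler_partialE (R : realType) (f : nat -> R[i]) (k : nat) :
  euler_partial f k
  = (fun N => \prod_(0 <= p < N) (if prime p then local_factor f k p else 1) : R[i]^o).
Proof. by apply/funext => N; rewrite /euler_partial big_mkcond. Qed.

Lemma bounded_sumZ_powRN (R : realType) (K dl : R) : 0 <= K -> 0 < dl ->
  exists B : R, forall N, \sum_(0 <= n < N) K * n%:R `^ (- (1 + dl)) <= B.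
Proof.
move=> K0 dl0; have [B hB] := bounded_sum_powRN dl0.
by exists (K * B) => N; rewrite -mulr_sumr ler_wpM2l.
Qed.

(* The first two conjuncts say that the series and the product defining the
   constant converge, so that it is not a default value of lim. *)
Theorem theorem3p8 (R : realType) (k : nat) (hk : (2 <= k)%N)
    (f : nat -> R[i]) (hf : class_A1 f) :
  [/\ forall p : nat, prime p -> local_series_cvg f k p,
      cvgn (euler_partial f k)
    & forall eps : R, 0 < eps ->
        exists K : R, \forall x \near +oo,
          `|lcm_sum f k x
            - euler_constant f k / (2 ^ k * k`!)%N%:R * (x ^+ k)%:C|
          <= (K * x `^ (k%:R - 4^-1 + eps))%:C].
Proof.
have local_cvg p : prime p -> local_series_cvg f k p.
  move=> pp; have [C [C1 hC]] := class_A1_maxpow hf.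
  by have [h _] := hC k p pp; apply: local_series_cvg_bound h; exact: prime_gt1.
have euler_cvg : cvgn (euler_partial f k).
  have dl : 0 < (2^-1 : R) <= 2^-1 by apply/andP; split; lra.
  have [K K0 hK] := local_bounds k hf dl; have /andP[dl0 _] := dl.
  have [B hB] := bounded_sumZ_powRN K0 dl0.
  rewrite euler_partialE; apply: cvgn_prod_normc hB => p.
  case: ifP => [pp|_]; first by have [_] := hK p pp.
  by rewrite subrr normc0 mulr_ge0 ?powR_ge0.
split=> // eps eps0.
(* the coefficients are summable against [\prod d_i^(theta - 2)] whenever
   [theta < 1/2] *)
pose dl : R := Num.min eps 2^-1.
have dl0 : 0 < dl by rewrite lt_min eps0 invr_gt0 ltr0n.
have dl1 : dl <= 2^-1 by rewrite ge_min lexx orbT.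
have dle : dl <= eps by rewrite ge_min lexx.
pose theta : R := 2^-1 - dl.
have ht : 0 <= theta <= 1 by rewrite /theta; apply/andP; split; lra.
have dl01 : 0 < dl <= 2^-1 by rewrite dl0 dl1.
have [K K0 hK] := local_bounds k hf dl01.
have [B hB] := bounded_sumZ_powRN K0 dl0.
have thetaE : theta - 2 = - (2^-1 + 1 + dl) by rewrite /theta; lra.
exists ((2 * k)%N%:R * expR B).
apply: filterS (nbhs_pinfty_ge (num_real (1 : R))) => x x1.
have x0 : 0 < x by apply: lt_le_trans x1.
rewrite normC_normc lecR.
set c := (2 ^ k * k`!)%N.
have -> : euler_constant f k / c%:R * (x ^+ k)%:C
    = (x ^+ k / c%:R)%:C * euler_constant f k.
  rewrite [in RHS]rmorphM /= [in RHS]fmorphV.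
  by rewrite rmorph_nat mulrAC [RHS]mulrAC [X in _ = X / _]mulrC.
apply: le_trans (_ : (2 * k)%N%:R * x `^ (k%:R - theta / 2) * expR B <= _); last first.
  rewrite mulrAC; apply: ler_wpM2l; first by rewrite mulr_ge0 ?expR_ge0.
  by rewrite ler_powR // /theta; lra.
(* [n_i <= n_i^2 <= x] for every [n] in the sum *)
pose M := (Num.truncn x).+1.
have hM (m : nat) : (m ^ 2)%:R <= x -> (m < M)%N.
  move=> mx; rewrite ltnS; have /andP[_ xM] := truncn_itv (ltW x0).
  have : (m ^ 2 < M)%N by rewrite -(ltr_nat R); exact: le_lt_trans xM.
  by rewrite ltnS; apply: leq_trans; case: (m) => // n; rewrite -mulnn leq_pmull.
(* first the exponents, then the primes, are allowed to be arbitrarily large *)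
apply: (normc_cvg_le euler_cvg).
exists M => // N /= MN.
have -> : euler_partial f k N = \prod_(q : prime_below N) local_factor f k (pval q).
  by rewrite /euler_partial big_prime_below.
have box_cvg := @cvg_prod_normc _ _ (index_enum (prime_below N)) _ _
  (fun q => local_factor_cvg (pval_prime q) (local_cvg _ (pval_prime q))).
apply: (normc_cvg_le box_cvg).
exists M => // E /= ME.
apply: le_trans (lcm_sum_truncated hf.1 _ x0 ht hM MN ME) _; first exact: ltnW.
apply: ler_wpM2l; first by rewrite mulr_ge0 ?powR_ge0.
apply: le_trans (_ : \prod_(q : prime_below N)
    (1 + K * (pval q)%:R `^ (- (1 + dl))) <= _).
  apply: ler_prod => q _; rewrite thetaE (hK _ (pval_prime q)).1 andbT.
  by apply: sumr_ge0 => mu _; rewrite mulr_ge0 ?normc_ge0 // exprn_ge0 ?powR_ge0.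
rewrite -(big_prime_below _ N (fun p => 1 + K * p%:R `^ (- (1 + dl)))) big_mkcond /=.
apply: le_trans (_ : expR (\sum_(0 <= n < N) K * n%:R `^ (- (1 + dl))) <= _).
  apply: prod_le_expR => n.
  have h0 : 0 <= K * n%:R `^ (- (1 + dl)) by rewrite mulr_ge0 ?powR_ge0.
  by case: ifP => _; apply/andP; split; move: h0; lra.
by rewrite ler_expR.
Qed.
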